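(* Let $\Sigma$ be a finite acyclic set of dependencies and $Q$ a safe BUCQ, both fixed. Deciding, given a database $\mathcal{D}$, whether $\langle\Sigma,\mathcal{D}\rangle$ IAR-entails $Q$ is in coNP with respect to data complexity.
   Context: A signature is a set of predicate symbols with arities, always containing a special 0-ary predicate $\bot$. A term is a constant or a variable; a (predicate) atom is $p(t_1,\dots,t_n)$; an inequality is $t\neq t'$. A database is a finite set of ground atoms (facts) not containing $\bot$. A conjunction with inequalities is a conjunction of at least one predicate atom or inequality. A CQ is $\exists\vec y\,\gamma$ with $\gamma$ a conjunction with inequalities; it is safe if every variable occurs in a predicate atom; a UCQ is a finite disjunction of CQs; a safe BUCQ is a UCQ without free variables all of whose CQs are safe. A dependency is a first-order sentence $\forall\vec x\,(\gamma\rightarrow Q')$ where $\gamma$ (the body) is a conjunction with inequalities whose variables are in $\vec x$, each occurring in some predicate atom of $\gamma$, and $Q'$ (the head) is a UCQ whose free variables are among $\vec x$ and in which every existentially quantified variable of each disjunct occurs in a predicate atom of that disjunct. $\mathcal{D}$ is consistent with $\Sigma$ if $\mathcal{D}$ satisfies every dependency of $\Sigma$. A repair of $\langle\Sigma,\mathcal{D}\rangle$ is an inclusion-maximal subset of $\mathcal{D}$ consistent with $\Sigma$. $\langle\Sigma,\mathcal{D}\rangle$ IAR-entails $Q$ if the intersection of all repairs satisfies $Q$. The dependency graph of $\Sigma$ has an edge from $\tau_1$ to $\tau_2$ iff the head of $\tau_1$ contains an atom whose predicate appears in a predicate atom of the body of $\tau_2$; $\Sigma$ is acyclic if this graph has no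 cycle. *)

(* Defs.v *)
From Stdlib Require Import List Arith NArith.
Import ListNotations.

Inductive term : Type := TConst (c : nat) | TVar (v : nat).

(* an atom is either the special 0-ary predicate bot, or p(t1,...,tn);
   the predicate symbol of p(t1..tn) is the pair (p, n) (name, arity) *)
Inductive atom : Type := ABot | APred (p : nat) (ts : list term).

Inductive lit : Type := LAtom (a : atom) | LNeq (t1 t2 : term).

(* CQ  exists cq_ex, /\ cq_body *)
Record cq : Type := { cq_ex : list nat; cq_body : list lit }.

(* dependency  forall x, /\ dep_body -> \/ dep_head ; x = variables of the body *)
Record dep : Type := { dep_body : list lit; dep_head : list cq }.

(* ground fact p(c1,...,cn) (bot cannot be represented, so databases never contain it) *)
Definition fact : Type := (nat * list nat)%type.
Definition database : Type := list fact.

Definition vars_term (t : term) : list nat :=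
  match t with TConst _ => [] | TVar v => [v] end.
Definition vars_atom (a : atom) : list nat :=
  match a with ABot => [] | APred _ ts => flat_map vars_term ts end.
Definition vars_lit (l : lit) : list nat :=
  match l with LAtom a => vars_atom a | LNeq t1 t2 => vars_term t1 ++ vars_term t2 end.
Definition vars_conj (g : list lit) : list nat := flat_map vars_lit g.
Definition atom_vars_conj (g : list lit) : list nat :=
  flat_map (fun l => match l with LAtom a => vars_atom a | LNeq _ _ => [] end) g.

Definition cq_safe (q : cq) : Prop :=
  cq_body q <> [] /\
  forall v, In v (cq_ex q) \/ In v (vars_conj (cq_body q)) ->
            In v (atom_vars_conj (cq_body q)).

Definition safe_bucq (Q : list cq) : Prop :=
  Q <> [] /\
  forall q, In q Q -> cq_safe q /\
    (forall v, In v (vars_conj (cq_body q)) -> In v (cq_ex q)).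

Definition dep_wf (d : dep) : Prop :=
  dep_body d <> [] /\
  (forall v, In v (vars_conj (dep_body d)) -> In v (atom_vars_conj (dep_body d))) /\
  dep_head d <> [] /\
  forall q, In q (dep_head d) ->
    cq_body q <> [] /\
    (forall v, In v (cq_ex q) -> In v (atom_vars_conj (cq_body q))) /\
    (forall v, In v (vars_conj (cq_body q)) -> ~ In v (cq_ex q) ->
               In v (vars_conj (dep_body d))).

Definition factset : Type := fact -> Prop.

Definition eval (nu : nat -> nat) (t : term) : nat :=
  match t with TConst c => c | TVar v => nu v end.

Definition sat_atom (S : factset) (nu : nat -> nat) (a : atom) : Prop :=
  match a with ABot => False | APred p ts => S (p, map (eval nu) ts) end.

Definition sat_lit (S : factset) (nu : nat -> nat) (l : lit) : Prop :=
  match l with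
  | LAtom a => sat_atom S nu a
  | LNeq t1 t2 => eval nu t1 <> eval nu t2
  end.

Definition sat_conj (S : factset) (nu : nat -> nat) (g : list lit) : Prop :=
  Forall (sat_lit S nu) g.

Definition sat_cq (S : factset) (nu : nat -> nat) (q : cq) : Prop :=
  exists nu' : nat -> nat,
    (forall v, ~ In v (cq_ex q) -> nu' v = nu v) /\ sat_conj S nu' (cq_body q).

Definition sat_ucq (S : factset) (nu : nat -> nat) (Q : list cq) : Prop :=
  Exists (sat_cq S nu) Q.

Definition sat_dep (S : factset) (d : dep) : Prop :=
  forall nu, sat_conj S nu (dep_body d) -> sat_ucq S nu (dep_head d).

Definition consistent (Sigma : list dep) (S : factset) : Prop :=
  Forall (sat_dep S) Sigma.

Definition is_repair (Sigma : list dep) (D : database) (R : factset) : Prop :=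
  (forall f, R f -> In f D) /\ consistent Sigma R /\
  forall R' : factset, (forall f, R f -> R' f) -> (forall f, R' f -> In f D) ->
    consistent Sigma R' -> forall f, R' f -> R f.

Definition iar_set (Sigma : list dep) (D : database) : factset :=
  fun f => In f D /\ forall R, is_repair Sigma D R -> R f.

(* Q has no free variables, so the valuation is irrelevant *)
Definition iar_entails (Sigma : list dep) (D : database) (Q : list cq) : Prop :=
  sat_ucq (iar_set Sigma D) (fun _ => 0) Q.

Definition sym_of_atom (a : atom) : option (nat * nat) :=
  match a with ABot => None | APred p ts => Some (p, length ts) end.
Definition syms_conj (g : list lit) : list (option (nat * nat)) :=
  flat_map (fun l => match l with LAtom a => [sym_of_atom a] | LNeq _ _ => [] end) g.
Definition head_syms (d : dep) := flat_map (fun q => syms_conj (cq_body q)) (dep_head d).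
Definition body_syms (d : dep) := syms_conj (dep_body d).

Definition dep_edge (d1 d2 : dep) : Prop :=
  exists s, In s (head_syms d1) /\ In s (body_syms d2).

Inductive dep_path (Sigma : list dep) : dep -> dep -> Prop :=
| dp_one d1 d2 : In d1 Sigma -> In d2 Sigma -> dep_edge d1 d2 -> dep_path Sigma d1 d2
| dp_step d1 d2 d3 : In d1 Sigma -> dep_edge d1 d2 -> dep_path Sigma d2 d3 ->
                     dep_path Sigma d1 d3.

Definition acyclic (Sigma : list dep) : Prop :=
  forall d, In d Sigma -> ~ dep_path Sigma d d.

Inductive move : Type := MLeft | MRight | MStay.
(* tape symbols: None = blank, Some None = separator, Some (Some b) = bit b *)
Definition sym : Type := option (option bool).

Record TM : Type := {
  tm_nstates : nat;
  tm_delta : nat -> sym -> (nat * sym * move);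
  tm_start : nat; tm_acc : nat; tm_rej : nat }.

Definition tm_wf (M : TM) : Prop :=
  tm_start M < tm_nstates M /\ tm_acc M < tm_nstates M /\
  tm_rej M < tm_nstates M /\ tm_acc M <> tm_rej M /\
  forall q s, q < tm_nstates M -> fst (fst (tm_delta M q s)) < tm_nstates M.

Record config : Type := { c_state : nat; c_left : list sym; c_head : sym; c_right : list sym }.

Definition tm_step (M : TM) (c : config) : config :=
  if orb (Nat.eqb (c_state c) (tm_acc M)) (Nat.eqb (c_state c) (tm_rej M)) then c else
  match tm_delta M (c_state c) (c_head c) with
  | (q', w, MStay) => Build_config q' (c_left c) w (c_right c)
  | (q', w, MLeft) =>
      match c_left c with
      | [] => Build_config q' [] w (c_right c)
      | x :: l => Build_config q' l x (w :: c_right c)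
      end
  | (q', w, MRight) =>
      match c_right c with
      | [] => Build_config q' (w :: c_left c) None []
      | x :: r => Build_config q' (w :: c_left c) x r
      end
  end.

Definition tm_init (M : TM) (w : list (option bool)) : config :=
  match w with
  | [] => Build_config (tm_start M) [] None []
  | x :: w' => Build_config (tm_start M) [] (Some x) (map Some w')
  end.

Definition tm_run (M : TM) (t : nat) (c : config) : config := Nat.iter t (tm_step M) c.

Definition decides_in (M : TM) (L : list (option bool) -> Prop) (T : nat -> nat) : Prop :=
  forall w, let c := tm_run M (T (length w)) (tm_init M w) in
    (c_state c = tm_acc M \/ c_state c = tm_rej M) /\ (c_state c = tm_acc M <-> L w).

Definition poly_bound (k n : nat) : nat := k * n ^ k + k.

Definition in_P (L : list (option bool) -> Prop) : Prop :=
  exists (M : TM) (k : nat), tm_wf M /\ decides_in M L (poly_bound k).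

Definition in_NP (L : list bool -> Prop) : Prop :=
  exists (k : nat) (V : list (option bool) -> Prop), in_P V /\
    forall x, L x <-> exists c : list bool,
      length c <= poly_bound k (length x) /\ V (map Some x ++ None :: map Some c).

Definition in_coNP (L : list bool -> Prop) : Prop := in_NP (fun x => ~ L x).

Fixpoint pos_bits (p : positive) : list bool :=
  match p with xH => [] | xO p' => false :: pos_bits p' | xI p' => true :: pos_bits p' end.
Definition nat_bits (n : nat) : list bool :=
  match N.of_nat n with N0 => [] | Npos p => true :: pos_bits p end.
(* self-delimiting binary encoding of a natural number *)
Definition enc_nat (n : nat) : list bool :=
  flat_map (fun b => [true; b]) (nat_bits n) ++ [false; false].
Definition enc_list {A} (f : A -> list bool) (l : list A) : list bool :=
  flat_map (fun x => [false; true] ++ f x) l ++ [false; false].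
Definition enc_fact (f : fact) : list bool := enc_nat (fst f) ++ enc_list enc_nat (snd f).
Definition enc_db (D : database) : list bool := enc_list enc_fact D.

Definition IAR_problem (Sigma : list dep) (Q : list cq) : list bool -> Prop :=
  fun w => exists D : database, w = enc_db D /\ iar_entails Sigma D Q.

(* Main.v *)
(* For an acyclic set of dependencies, a consistent subset R of D is a repair iff
   adding any single fact of D - R makes it inconsistent: if R' is a consistent
   proper superset of R, a fact of R' - R whose predicate is as far downstream as
   possible can be added alone to R.  Hence checking a repair is first-order in D,
   and a certificate for non-entailment lists, for each fact outside the
   intersection of the repairs, a repair that misses it, as a bit mask over the
   input; Q must fail in the intersection of the listed repairs.

   The verifier is a first-order sentence over the positions of the input word,
   with addition of positions and with the state of a finite automaton that parses
   the encoding as atomic relations.  Such a sentence is evaluated in polynomial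
   time by a program over registers that point to positions, and each instruction
   of this program is one sweep of a Turing machine over a tape on which every
   input symbol is followed by one mark per register. *)
From Stdlib Require Import Arith NArith Lia Bool Classical FunctionalExtensionality.
Require Import Defs.
From Stdlib Require Import List.
Import ListNotations.

(** * Turing machines with an arbitrary finite state type *)

(** Soundness does not rest on a well-formed certificate: every position is tried as the start of a
    mask, and masks that do not describe a repair are discarded. The facts kept by all remaining
    masks thus include the intersection of all repairs. Since inequalities do not depend on the
    facts, [Q] is monotone, so its failure in this larger set implies its failure in the
    intersection. The numbers in a fact have unbounded length, whereas a formula can only name
    positions. A variable is therefore assigned a position at which its value is written. Nothing is
    lost, because safety makes every relevant value occur in some fact. Addition of positions serves
    to compare two numbers bit by bit at equal offsets and to find the mask bit that belongs to a
    fact. *)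

Section IndexOf.
Context {A : Type} (eq_dec : forall x y : A, {x = y} + {x <> y}).

Fixpoint index_of (x : A) (l : list A) : nat :=
  match l with
  | [] => 0
  | y :: l' => if eq_dec x y then 0 else S (index_of x l')
  end.

Lemma index_of_lt x l : In x l -> index_of x l < length l.
Proof.
  induction l as [|y l IH]; cbn; [tauto|].
  destruct (eq_dec x y); intros [?|?]; try lia; [congruence|].
  specialize (IH H). lia.
Qed.

Lemma nth_index_of x l d : In x l -> nth (index_of x l) l d = x.
Proof.
  induction l as [|y l IH]; cbn; [tauto|].
  destruct (eq_dec x y); intros [?|?]; auto; congruence.
Qed.

Lemma index_of_inj x y l : In x l -> index_of x l = index_of y l -> In y l -> x = y.
Proof.
  intros Hx E Hy. rewrite <- (nth_index_of x l x Hx), E. now apply nth_index_of.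
Qed.
End IndexOf.

Section FiniteMachine.
Context {A : Type} (eq_dec : forall x y : A, {x = y} + {x <> y}).
Variables (all : list A) (delta : A -> sym -> A * sym * move) (s0 acc rej : A).

Definition code_state (s : A) : nat := index_of eq_dec s all.

Definition machine : TM := {|
  tm_nstates := length all;
  tm_delta := fun q a =>
    let '(s, b, m) := delta (nth q all s0) a in (code_state s, b, m);
  tm_start := code_state s0; tm_acc := code_state acc; tm_rej := code_state rej |}.

Hypothesis s0_in : In s0 all.
Hypothesis acc_in : In acc all.
Hypothesis rej_in : In rej all.
Hypothesis acc_rej : acc <> rej.
Hypothesis delta_in : forall s a, In s all -> In (fst (fst (delta s a))) all.

Lemma machine_wf : tm_wf machine.
Proof.
  repeat split; cbn; try (now apply index_of_lt).
  - intros E. apply acc_rej. now apply (index_of_inj eq_dec _ _ all).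
  - intros q a Hq. specialize (delta_in (nth q all s0) a (nth_In _ _ Hq)).
    destruct (delta (nth q all s0) a) as [[s b] m]. now apply index_of_lt.
Qed.

(* The head scans the first symbol of [r]; an empty [r] stands for a blank. *)
Definition mkc (s : A) (l r : list sym) : config :=
  match r with
  | [] => Build_config (code_state s) l None []
  | x :: r' => Build_config (code_state s) l x r'
  end.

Lemma mkc_state s l r : c_state (mkc s l r) = code_state s.
Proof. now destruct r. Qed.

Lemma tm_init_mkc w : tm_init machine w = mkc s0 [] (map Some w).
Proof. now destruct w. Qed.

Lemma running_state s : In s all -> s <> acc -> s <> rej ->
  (code_state s =? code_state acc) || (code_state s =? code_state rej) = false.
Proof.
  intros Hs Ha Hr. apply orb_false_iff. split; apply Nat.eqb_neq; intros E.
  - apply Ha. now apply (index_of_inj eq_dec _ _ all).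
  - apply Hr. now apply (index_of_inj eq_dec _ _ all).
Qed.

Lemma step_right s l r s' b : In s all -> s <> acc -> s <> rej ->
  delta s (hd None r) = (s', b, MRight) ->
  tm_step machine (mkc s l r) = mkc s' (b :: l) (tl r).
Proof.
  intros Hs Ha Hr E. unfold tm_step. rewrite mkc_state.
  cbn [machine tm_acc tm_rej]. rewrite (running_state s Hs Ha Hr).
  destruct r as [|x r]; cbn in *; unfold code_state at 1;
    rewrite nth_index_of by assumption; rewrite E; [reflexivity|now destruct r].
Qed.

Lemma step_left s y l r s' b : In s all -> s <> acc -> s <> rej ->
  delta s (hd None r) = (s', b, MLeft) ->
  tm_step machine (mkc s (y :: l) r) = mkc s' l (y :: b :: tl r).
Proof.
  intros Hs Ha Hr E. unfold tm_step. rewrite mkc_state.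
  cbn [machine tm_acc tm_rej]. rewrite (running_state s Hs Ha Hr).
  destruct r as [|x r]; cbn in *; unfold code_state at 1;
    rewrite nth_index_of by assumption; now rewrite E.
Qed.

Lemma tm_run_add M t t' c : tm_run M (t + t') c = tm_run M t' (tm_run M t c).
Proof. unfold tm_run. rewrite Nat.add_comm. apply Nat.iter_add. Qed.

Lemma tm_run_S M t c : tm_run M (S t) c = tm_run M t (tm_step M c).
Proof. apply (tm_run_add M 1 t c). Qed.

(** [decides_in] inspects the configuration at one prescribed time; since [tm_step] fixes halting
    configurations, a run that halts earlier can be padded up to it. *)
Lemma tm_run_halted M t c : c_state c = tm_acc M \/ c_state c = tm_rej M ->
  tm_run M t c = c.
Proof.
  intros H. induction t as [|t IH]; [reflexivity|]. rewrite tm_run_S.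
  replace (tm_step M c) with c; [assumption|]. unfold tm_step.
  replace (_ || _) with true; [reflexivity|]. symmetry.
  apply orb_true_iff. rewrite !Nat.eqb_eq. tauto.
Qed.

Section ScanRight.
Context {B : Type} (wrap : B -> A) (step : B -> sym -> B * sym) (ok : B -> Prop).

Fixpoint transduce (x : B) (u : list sym) : B * list sym :=
  match u with
  | [] => (x, [])
  | a :: u' => let '(y, b) := step x a in
               let '(z, v) := transduce y u' in (z, b :: v)
  end.

Lemma transduce_app x u v :
  transduce x (u ++ v) =
  let '(y, u') := transduce x u in let '(z, v') := transduce y v in (z, u' ++ v').
Proof.
  revert x. induction u as [|a u IH]; intros x; cbn.
  - now destruct (transduce x v).
  - destruct (step x a) as [y b]. rewrite IH.
    destruct (transduce y u) as [z u']. now destruct (transduce z v).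
Qed.

(** On nonblank symbols the machine acts as the sequential transducer [step], whose states are
    embedded by [wrap]; the invariant [ok] keeps them within the finite list [all]. *)
Lemma scan_right :
  (forall x, ok x -> In (wrap x) all /\ wrap x <> acc /\ wrap x <> rej) ->
  (forall x (a : sym), ok x -> a <> None -> ok (fst (step x a)) /\
     delta (wrap x) a = (wrap (fst (step x a)), snd (step x a), MRight)) ->
  forall (u : list sym) x (l r : list sym) z v, ok x -> Forall (fun a : sym => a <> None) u ->
    transduce x u = (z, v) ->
    tm_run machine (length u) (mkc (wrap x) l (u ++ r)) = mkc (wrap z) (rev v ++ l) r
    /\ ok z.
Proof.
  intros Hin Hd u. induction u as [|a u IH]; intros x l r z v Hx Hu E.
  - injection E as <- <-. now split.
  - inversion_clear Hu as [|? ? Ha Hu']. cbn [length app transduce] in *.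
    destruct (Hin x Hx) as (H1 & H2 & H3). destruct (Hd x a Hx Ha) as [Hok Hda].
    rewrite tm_run_S, (step_right _ _ _ (wrap (fst (step x a))) (snd (step x a))); auto.
    destruct (step x a) as [y b]. destruct (transduce y u) as [z' v'] eqn:E'.
    injection E as <- <-. cbn [fst snd rev tl] in *. rewrite <- app_assoc.
    exact (IH y (b :: l) r z' v' Hok Hu' E').
Qed.
End ScanRight.

(** The last step enters the cell of [y] without reading it, so [y] may be blank: in this way a
    return sweep ends on the blank that delimits the blocks. *)
Lemma scan_left s : In s all -> s <> acc -> s <> rej ->
  (forall a : sym, a <> None -> delta s a = (s, a, MLeft)) ->
  forall (u : list sym) (x y : sym) (l r : list sym),
    x <> None -> Forall (fun a : sym => a <> None) u ->
    tm_run machine (S (length u)) (mkc s (u ++ y :: l) (x :: r))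
    = mkc s l (y :: rev u ++ x :: r).
Proof.
  intros Hs Ha Hr Hd u. induction u as [|a u IH]; intros x y l r Hx Hu.
  - change (tm_step machine (mkc s (y :: l) (x :: r)) = mkc s l (y :: x :: r)).
    now rewrite (step_left s y l (x :: r) s x) by auto.
  - inversion_clear Hu as [|? ? Hna Hu']. cbn [length app].
    rewrite tm_run_S, (step_left s a _ (x :: r) s x) by auto.
    cbn [tl]. rewrite (IH a y l (x :: r)) by auto. cbn [rev]. now rewrite <- app_assoc.
Qed.

Lemma turn_left s s' b : In s all -> s <> acc -> s <> rej ->
  In s' all -> s' <> acc -> s' <> rej ->
  (forall a : sym, a <> None -> delta s' a = (s', a, MLeft)) ->
  forall (u : list sym) (y : sym) (l r : list sym),
    delta s (hd None r) = (s', b, MLeft) -> Forall (fun a : sym => a <> None) u ->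
    tm_run machine (S (length u)) (mkc s (u ++ y :: l) r) = mkc s' l (y :: rev u ++ b :: tl r).
Proof.
  intros Hs Ha Hr Hs' Ha' Hr' Hd u y l r E Hu. rewrite tm_run_S. destruct Hu as [|x u Hx Hu].
  - cbn [app]. now rewrite (step_left s y l r s' b).
  - cbn [app]. rewrite (step_left s x _ r s' b) by assumption. cbn [length].
    rewrite (scan_left s') by assumption. cbn [rev]. now rewrite <- app_assoc.
Qed.
End FiniteMachine.

(** * Register programs over a string, executed by tape sweeps *)

(* States of a parser of [enc_db]: a fact starts in [PPred], an argument in [PArg],
   and [PArgs] is reached exactly after each number. *)
Inductive pstate : Type :=
  PDb | PDb0 | PPred | PArg | PNat | PEnd | PLead | PBit | PArgs | PArgs0 | PDone | PDead.

Definition pnext (q : pstate) (c : option bool) : pstate :=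
  match q, c with
  | PDb, Some false => PDb0
  | PDb0, Some true => PPred
  | PDb0, Some false => PDone
  | (PPred | PArg), Some false => PEnd
  | (PPred | PArg), Some true => PLead
  | PLead, Some true => PNat
  | PNat, Some false => PEnd
  | PNat, Some true => PBit
  | PBit, Some _ => PNat
  | PEnd, Some false => PArgs
  | PArgs, Some false => PArgs0
  | PArgs0, Some true => PArg
  | PArgs0, Some false => PDb
  | _, _ => PDead
  end.

Definition prun (q : pstate) (w : list (option bool)) : pstate := fold_left pnext w q.

Lemma prun_app q u v : prun q (u ++ v) = prun (prun q u) v.
Proof. apply fold_left_app. Qed.

Definition pstate_dec (q q' : pstate) : {q = q'} + {q <> q'}.
Proof. decide equality. Defined.
Definition osym_dec (a b : option bool) : {a = b} + {a <> b}.
Proof. repeat decide equality. Defined.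
Definition pstate_eqb q q' : bool := if pstate_dec q q' then true else false.
Definition osym_eqb a b : bool := if osym_dec a b then true else false.

Inductive op : Type :=
| OZero (i : nat) | OInc (i : nat) | OCopy (i k : nat)
| OEq (i k : nat) | OSym (a : option bool) (i : nat) | ODfa (q : pstate) (i : nat).

Record instr : Type := { i_op : op; i_true : nat; i_false : nat }.

Definition regs : Type := nat -> nat.
Definition upd (e : nat -> nat) (i p : nat) : nat -> nat :=
  fun j => if j =? i then p else e j.

Definition op_regs (o : op) (e : regs) : regs :=
  match o with
  | OZero i => upd e i 0
  | OInc i => upd e i (S (e i))
  | OCopy i k => upd e k (e i)
  | _ => e
  end.

(** A register that points past the input has no mark on the tape, so every test on it has to fail;
    in particular [OEq i i] tests whether register [i] is still inside the word, which is how loops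
    terminate. *)
Definition op_test (o : op) (w : list (option bool)) (e : regs) : bool :=
  match o with
  | OEq i k => (e i <? length w) && (e i =? e k)
  | OSym a i => (e i <? length w) && osym_eqb (nth (e i) w None) a
  | ODfa q i => (e i <? length w) && pstate_eqb (prun PDb (firstn (e i) w)) q
  | _ => true
  end.

(** The marks of a block are read from left to right, so the mark to be remembered has to come
    before the mark that is written or compared. *)
Definition op_ok (K : nat) (o : op) : Prop :=
  match o with
  | OZero i | OInc i | OSym _ i | ODfa _ i => i < K
  | OCopy i k => i < k < K
  | OEq i k => i <= k < K
  end.

Definition is_test (o : op) : bool :=
  match o with OEq _ _ | OSym _ _ | ODfa _ _ => true | _ => false end.

(* A block holds an input symbol followed by [K] marks, the [i]-th of which
   tells whether register [i] points to this block. *)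
Definition bsym (b : bool) : sym := Some (Some b).
Definition isone (a : sym) : bool := match a with Some (Some true) => true | _ => false end.

Definition flags : Type := (bool * bool * pstate)%type.
Definition flags0 : flags := (false, false, PDb).

(* Effect of a sweep on cell [j] of a block: the first flag accumulates the
   result of the sweep, the second one remembers a bit of the current block. *)
Definition cellop (o : op) (j : nat) (st : flags) (a : sym) : flags * sym :=
  let '(f, g, q) := st in
  match o with
  | OZero i => if j =? S i then ((true, g, q), bsym (negb f)) else (st, a)
  | OInc i => if j =? S i then ((isone a, g, q), bsym f) else (st, a)
  | OCopy i k =>
      if j =? S i then ((f, isone a, q), a)
      else if j =? S k then (st, bsym g) else (st, a)
  | OEq i k =>
      let g' := if j =? S i then isone a else g in
      ((if j =? S k then f || (g' && isone a) else f, g', q), a)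
  | OSym b i =>
      if j =? 0 then ((f, match a with Some c => osym_eqb c b | None => g end, q), a)
      else if j =? S i then ((f || (g && isone a), g, q), a) else (st, a)
  | ODfa q0 i =>
      if j =? 0 then
        (match a with Some c => (f, pstate_eqb q q0, pnext q c) | None => st end, a)
      else if j =? S i then ((f || (g && isone a), g, q), a) else (st, a)
  end.

Section Sweep.
Variable K : nat.

Definition sweep_step (o : op) (x : nat * flags) (a : sym) : (nat * flags) * sym :=
  let '(st, b) := cellop o (fst x) (snd x) a in
  ((if fst x =? K then 0 else S (fst x), st), b).

Definition marks (e : regs) (p : nat) : list sym :=
  map (fun i => bsym (e i =? p)) (seq 0 K).

Fixpoint tape (p : nat) (w : list (option bool)) (e : regs) : list sym :=
  match w with
  | [] => []
  | c :: w' => (Some c :: marks e p) ++ tape (S p) w' e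
  end.

Lemma tape_length p w e : length (tape p w e) = length w * S K.
Proof.
  revert p. induction w as [|c w IH]; intros p; cbn; [reflexivity|].
  rewrite length_app, IH. unfold marks. rewrite length_map, length_seq. lia.
Qed.

Lemma tape_nonblank p w e : Forall (fun a : sym => a <> None) (tape p w e).
Proof.
  revert p. induction w as [|c w IH]; intros p; cbn; constructor; [discriminate|].
  apply Forall_app. split; [|apply IH]. apply Forall_map, Forall_forall. discriminate.
Qed.

(* [stf p j] is the state in which the sweep reaches cell [j] of block [p]. *)
Lemma transduce_tape o e e' (stf : nat -> nat -> flags) w p0 :
  (forall p c, nth_error w p = Some c ->
     cellop o 0 (stf (p0 + p) 0) (Some c) = (stf (p0 + p) 1, Some c)) ->
  (forall p i, i < K -> cellop o (S i) (stf p (S i)) (bsym (e i =? p))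
     = (stf p (S (S i)), bsym (e' i =? p))) ->
  (forall p, stf p (S K) = stf (S p) 0) -> 0 < K ->
  transduce (sweep_step o) (0, stf p0 0) (tape p0 w e)
  = ((0, stf (p0 + length w) 0), tape p0 w e').
Proof.
  intros H0 H1 H2 HK. revert p0 H0. induction w as [|c w IH]; intros p0 H0.
  - cbn. now rewrite Nat.add_0_r.
  - cbn [tape]. rewrite transduce_app.
    replace (transduce (sweep_step o) (0, stf p0 0) (Some c :: marks e p0))
      with ((0, stf p0 (S K)), Some c :: marks e' p0).
    + rewrite H2, IH.
      * cbn [length]. now rewrite Nat.add_succ_r.
      * intros p d E. specialize (H0 (S p) d E).
        now rewrite Nat.add_succ_r in H0.
    + specialize (H0 0 c eq_refl). rewrite Nat.add_0_r in H0.
      cbn [transduce]. unfold sweep_step at 1. cbn [fst snd]. rewrite H0.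
      destruct (Nat.eqb_spec 0 K); [lia|].
      assert (M : forall k a, 0 < k -> a + k = K ->
        transduce (sweep_step o) (S a, stf p0 (S a)) (map (fun i => bsym (e i =? p0)) (seq a k))
        = ((0, stf p0 (S K)), map (fun i => bsym (e' i =? p0)) (seq a k))).
      { induction k as [|k IHk]; intros a Hk E; [lia|].
        cbn [seq map transduce]. unfold sweep_step at 1. cbn [fst snd].
        rewrite (H1 p0 a) by lia. destruct (Nat.eqb_spec (S a) K).
        - assert (k = 0) by lia. subst k. cbn. now rewrite <- e0.
        - rewrite IHk by lia. reflexivity. }
      unfold marks. now rewrite M.
Qed.

(** The mark that a sweep carries over from the preceding block; there is none before block 0. *)
Definition seen (e : regs) (i p : nat) : bool :=
  match p with 0 => false | S p' => e i =? p' end.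

Lemma lt_S_split i p : (i <? S p) = (i <? p) || (i =? p).
Proof.
  destruct (Nat.ltb_spec i (S p)), (Nat.ltb_spec i p), (Nat.eqb_spec i p); cbn; lia.
Qed.

Lemma isone_bsym b : isone (bsym b) = b.
Proof. now destruct b. Qed.

Lemma cell_eq (f f' g g' : bool) (q : pstate) (a a' : sym) :
  f = f' -> g = g' -> a = a' -> (f, g, q, a) = (f', g', q, a').
Proof. congruence. Qed.

Lemma firstn_S_snoc {T} (w : list T) p c :
  nth_error w p = Some c -> firstn (S p) w = firstn p w ++ [c].
Proof.
  revert w. induction p as [|p IH]; intros [|d w] E; try discriminate.
  - cbn in E. injection E as ->. reflexivity.
  - cbn in E. change (d :: firstn (S p) w = d :: firstn p w ++ [c]). now rewrite (IH w E).
Qed.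

(** The flags are given in closed form at every cell, which reduces the effect of a sweep to one
    local check per cell. *)
Lemma sweep_op o w e : op_ok K o -> exists st',
  transduce (sweep_step o) (0, flags0) (tape 0 w e) = ((0, st'), tape 0 w (op_regs o e))
  /\ (is_test o = true -> fst (fst st') = op_test o w e).
Proof.
  intros Hok.
  assert (Main : exists stf : nat -> nat -> flags,
    stf 0 0 = flags0 /\
    (forall p c, nth_error w p = Some c ->
       cellop o 0 (stf p 0) (Some c) = (stf p 1, Some c)) /\
    (forall p i, i < K -> cellop o (S i) (stf p (S i)) (bsym (e i =? p))
       = (stf p (S (S i)), bsym (op_regs o e i =? p))) /\
    (forall p, stf p (S K) = stf (S p) 0) /\
    (is_test o = true -> fst (fst (stf (length w) 0)) = op_test o w e)).
  { destruct o as [i|i|i k|i k|a i|q0 i]; cbn in Hok.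
    (* [OZero]: the first flag is raised once cell [S i] of block 0 has been passed. *)
    - exists (fun p j => (negb (p =? 0) || (S i <? j), false, PDb)).
      repeat split; try discriminate.
      + intros p j Hj. cbn [cellop op_regs]. unfold upd.
        replace (S j =? S i) with (j =? i) by reflexivity.
        destruct (Nat.eqb_spec j i) as [->|N].
        * replace (S i <? S i) with false by (symmetry; apply Nat.ltb_irrefl).
          replace (S i <? S (S i)) with true by (symmetry; apply Nat.ltb_lt; lia).
          rewrite orb_true_r, orb_false_r, negb_involutive. now rewrite Nat.eqb_sym.
        * replace (S i <? S (S j)) with (S i <? S j); [reflexivity|].
          destruct (Nat.ltb_spec (S i) (S j)), (Nat.ltb_spec (S i) (S (S j))); lia.
      + intros p. replace (S i <? S K) with true by (symmetry; apply Nat.ltb_lt; lia).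
        now rewrite orb_true_r.
    (* [OInc]: the first flag delays the mark by one block; a mark that leaves the last block
       disappears, as a position past the end should. *)
    - exists (fun p j => (if S i <? j then e i =? p else seen e i p, false, PDb)).
      repeat split; try discriminate.
      + intros p j Hj. cbn [cellop op_regs]. unfold upd.
        replace (S j =? S i) with (j =? i) by reflexivity.
        destruct (Nat.eqb_spec j i) as [->|N].
        * replace (S i <? S i) with false by (symmetry; apply Nat.ltb_irrefl).
          replace (S i <? S (S i)) with true by (symmetry; apply Nat.ltb_lt; lia).
          rewrite isone_bsym. f_equal. f_equal. now destruct p.
        * replace (S i <? S (S j)) with (S i <? S j); [reflexivity|].
          destruct (Nat.ltb_spec (S i) (S j)), (Nat.ltb_spec (S i) (S (S j))); lia.
      + intros p. now replace (S i <? S K) with true by (symmetry; apply Nat.ltb_lt; lia).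
    - exists (fun p j => (false, if S i <? j then e i =? p else seen e i p, PDb)).
      repeat split; try discriminate.
      + intros p j Hj. cbn [cellop op_regs]. unfold upd.
        replace (S j =? S i) with (j =? i) by reflexivity.
        replace (S j =? S k) with (j =? k) by reflexivity.
        destruct (Nat.eqb_spec j i) as [->|N].
        * replace (S i <? S (S i)) with true by (symmetry; apply Nat.ltb_lt; lia).
          rewrite isone_bsym. now destruct (Nat.eqb_spec i k); [lia|].
        * replace (S i <? S (S j)) with (S i <? S j)
            by (destruct (Nat.ltb_spec (S i) (S j)), (Nat.ltb_spec (S i) (S (S j))); lia).
          destruct (Nat.eqb_spec j k) as [->|N']; [|reflexivity].
          now replace (S i <? S k) with true by (symmetry; apply Nat.ltb_lt; lia).
      + intros p. now replace (S i <? S K) with true by (symmetry; apply Nat.ltb_lt; lia).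
    (* [OEq]: a common position counts as found once cell [S k] of its block has been passed. *)
    - exists (fun p j => ((e i =? e k) && (e k <? if S k <? j then S p else p),
                          if S i <? j then e i =? p else seen e i p, PDb)).
      repeat split; try discriminate.
      + cbn. now rewrite andb_false_r.
      + intros p j Hj. cbn [cellop op_regs].
        replace (S j =? S i) with (j =? i) by reflexivity.
        replace (S j =? S k) with (j =? k) by reflexivity.
        rewrite isone_bsym. apply cell_eq; [| |reflexivity].
        * destruct (Nat.eqb_spec j k) as [->|N].
          -- replace (S k <? S k) with false by (symmetry; apply Nat.ltb_irrefl).
             replace (S k <? S (S k)) with true by (symmetry; apply Nat.ltb_lt; lia).
             replace (if k =? i then e k =? p else if S i <? S k then e i =? p else seen e i p)
               with (e i =? p).
             ++ rewrite lt_S_split.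
                destruct (Nat.eqb_spec (e i) (e k)) as [->|], (e k <? p),
                  (Nat.eqb_spec (e k) p), (Nat.eqb_spec (e i) p); cbn; congruence.
             ++ destruct (Nat.eqb_spec k i) as [->|]; [reflexivity|].
                now replace (S i <? S k) with true by (symmetry; apply Nat.ltb_lt; lia).
          -- replace (S k <? S (S j)) with (S k <? S j); [reflexivity|].
             destruct (Nat.ltb_spec (S k) (S j)), (Nat.ltb_spec (S k) (S (S j))); lia.
        * destruct (Nat.eqb_spec j i) as [->|N].
          -- now replace (S i <? S (S i)) with true by (symmetry; apply Nat.ltb_lt; lia).
          -- replace (S i <? S (S j)) with (S i <? S j); [reflexivity|].
             destruct (Nat.ltb_spec (S i) (S j)), (Nat.ltb_spec (S i) (S (S j))); lia.
      + intros p. replace (S i <? S K) with true by (symmetry; apply Nat.ltb_lt; lia).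
        now replace (S k <? S K) with true by (symmetry; apply Nat.ltb_lt; lia).
      + intros _. cbn.
        destruct (Nat.eqb_spec (e i) (e k)) as [->|]; now rewrite ?andb_false_r, ?andb_true_r.
    - exists (fun p j =>
        ((e i <? if S i <? j then S p else p) && osym_eqb (nth (e i) w None) a,
         match j with
         | 0 => match p with 0 => false | S p' => osym_eqb (nth p' w None) a end
         | _ => osym_eqb (nth p w None) a end, PDb)).
      repeat split; try discriminate.
      + intros p c E. cbn. now rewrite (nth_error_nth w p None E).
      + intros p j Hj. cbn [cellop op_regs].
        replace (S j =? S i) with (j =? i) by reflexivity.
        replace (S j =? 0) with false by reflexivity.
        rewrite isone_bsym. destruct (Nat.eqb_spec j i) as [->|N].
        * replace (S i <? S i) with false by (symmetry; apply Nat.ltb_irrefl).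
          replace (S i <? S (S i)) with true by (symmetry; apply Nat.ltb_lt; lia).
          rewrite lt_S_split. apply cell_eq; try reflexivity.
          destruct (e i <? p), (Nat.eqb_spec (e i) p) as [->|]; cbn;
            now rewrite ?andb_true_r, ?andb_false_r, ?orb_diag, ?orb_false_r.
        * replace (S i <? S (S j)) with (S i <? S j); [reflexivity|].
          destruct (Nat.ltb_spec (S i) (S j)), (Nat.ltb_spec (S i) (S (S j))); lia.
      + intros p. now replace (S i <? S K) with true by (symmetry; apply Nat.ltb_lt; lia).
    (* [ODfa]: from cell 1 on, the parser state includes the symbol of block [p], while the
       comparison kept in the second flag was made before that symbol. *)
    - exists (fun p j =>
        ((e i <? if S i <? j then S p else p) && pstate_eqb (prun PDb (firstn (e i) w)) q0,
         match j with
         | 0 => match p with 0 => false | S p' => pstate_eqb (prun PDb (firstn p' w)) q0 end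
         | _ => pstate_eqb (prun PDb (firstn p w)) q0 end,
         prun PDb (firstn (match j with 0 => p | _ => S p end) w))).
      repeat split; try discriminate.
      + intros p c E. cbn [cellop Nat.eqb]. rewrite (firstn_S_snoc w p c E), prun_app.
        now replace (S i <? 1) with (S i <? 0) by (destruct i; reflexivity).
      + intros p j Hj. cbn [cellop op_regs].
        replace (S j =? S i) with (j =? i) by reflexivity.
        replace (S j =? 0) with false by reflexivity.
        rewrite isone_bsym. destruct (Nat.eqb_spec j i) as [->|N].
        * replace (S i <? S i) with false by (symmetry; apply Nat.ltb_irrefl).
          replace (S i <? S (S i)) with true by (symmetry; apply Nat.ltb_lt; lia).
          rewrite lt_S_split. apply cell_eq; try reflexivity.
          destruct (e i <? p), (Nat.eqb_spec (e i) p) as [->|]; cbn [orb andb];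
            now rewrite ?andb_true_r, ?andb_false_r, ?orb_diag, ?orb_false_r.
        * replace (S i <? S (S j)) with (S i <? S j); [reflexivity|].
          destruct (Nat.ltb_spec (S i) (S j)), (Nat.ltb_spec (S i) (S (S j))); lia.
      + intros p. now replace (S i <? S K) with true by (symmetry; apply Nat.ltb_lt; lia). }
  destruct Main as (stf & E0 & H0 & H1 & H2 & H3).
  exists (stf (length w) 0). split; [|assumption].
  rewrite <- E0. apply (transduce_tape o e (op_regs o e) stf w 0); auto.
  destruct o; cbn in Hok; lia.
Qed.
End Sweep.

(* The states before [Sweep] move the input, symbol by symbol, to the right of a
   blank and expand each symbol to a block with empty marks. *)
Inductive mstate : Type :=
| IFetch | ICopy (c : option bool) | IAppend (c : option bool) | IMark (j : nat)
| IBack | IBack2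
| Sweep (pc j : nat) (st : flags) | Return (pc : nat) | Accept | Reject.

Definition mstate_dec (s s' : mstate) : {s = s'} + {s <> s'}.
Proof. repeat decide equality. Defined.

Section SweepMachine.
Variables (K : nat) (code : list instr).
Hypothesis K_pos : 0 < K.

Definition fetch (pc : nat) : instr := nth pc code (Build_instr (OEq 0 0) 0 0).

Definition goto (pc : nat) : mstate :=
  if pc <? length code then Sweep pc 0 flags0
  else if pc =? length code then Accept else Reject.

(** Jump targets are capped at [S (length code)] to keep the state set finite; the cap is harmless
    because [goto] sends every address above [length code] to [Reject]. *)
Definition mdelta (s : mstate) (a : sym) : mstate * sym * move :=
  match s, a with
  | IFetch, Some c => (ICopy c, None, MRight)
  | IFetch, None => (goto 0, None, MRight)
  | ICopy c, Some _ => (ICopy c, a, MRight)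
  | ICopy c, None => (IAppend c, None, MRight)
  | IAppend c, Some _ => (IAppend c, a, MRight)
  | IAppend c, None => (IMark 0, Some c, MRight)
  | IMark j, _ => if S j =? K then (IBack, bsym false, MLeft)
                  else (IMark (S j), bsym false, MRight)
  | IBack, Some _ => (IBack, a, MLeft)
  | IBack, None => (IBack2, None, MLeft)
  | IBack2, Some _ => (IBack2, a, MLeft)
  | IBack2, None => (IFetch, None, MRight)
  | Sweep pc j st, Some _ =>
      let '((j', st'), b) := sweep_step K (i_op (fetch pc)) (j, st) a in
      (Sweep pc j' st', b, MRight)
  | Sweep pc j st, None =>
      let i := fetch pc in
      (Return (Nat.min (if fst (fst st) then i_true i else i_false i) (S (length code))),
       None, MLeft)
  | Return pc, Some _ => (Return pc, a, MLeft)
  | Return pc, None => (goto pc, None, MRight)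
  | Accept, _ => (Accept, a, MStay)
  | Reject, _ => (Reject, a, MStay)
  end.

Definition all_bools : list bool := [true; false].
Definition all_pstates : list pstate :=
  [PDb; PDb0; PPred; PArg; PNat; PEnd; PLead; PBit; PArgs; PArgs0; PDone; PDead].
Definition all_flags : list flags := list_prod (list_prod all_bools all_bools) all_pstates.
Definition all_osyms : list (option bool) := [None; Some true; Some false].

Definition all_mstates : list mstate :=
  [IFetch; IBack; IBack2; Accept; Reject]
  ++ map ICopy all_osyms ++ map IAppend all_osyms ++ map IMark (seq 0 K)
  ++ map Return (seq 0 (S (S (length code))))
  ++ map (fun x => Sweep (fst (fst x)) (snd (fst x)) (snd x))
       (list_prod (list_prod (seq 0 (length code)) (seq 0 (S K))) all_flags).

Lemma in_all_flags st : In st all_flags.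
Proof.
  destruct st as [[f g] q]. repeat apply in_prod.
  - destruct f; cbn; tauto.
  - destruct g; cbn; tauto.
  - destruct q; cbn; tauto.
Qed.

Lemma in_all_osyms c : In c all_osyms.
Proof. destruct c as [[|]|]; cbn; tauto. Qed.

Lemma in_all_mstates s :
  In s all_mstates <->
  match s with
  | IMark j => j < K
  | Sweep pc j _ => pc < length code /\ j <= K
  | Return pc => pc <= S (length code)
  | _ => True
  end.
Proof.
  unfold all_mstates. rewrite !in_app_iff, !in_map_iff. split.
  - intros [H|[H|[H|[H|[H|H]]]]].
    + cbn in H. intuition (subst; exact I).
    + destruct H as (? & <- & _). exact I.
    + destruct H as (? & <- & _). exact I.
    + destruct H as (? & <- & H). apply in_seq in H. lia.
    + destruct H as (? & <- & H). apply in_seq in H. lia.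
    + destruct H as ([[pc j] st] & <- & H). cbn.
      rewrite !in_prod_iff, !in_seq in H. lia.
  - intros H. destruct s.
    + left. cbn. tauto.
    + right. left. exists c. split; [reflexivity|apply in_all_osyms].
    + right. right. left. exists c. split; [reflexivity|apply in_all_osyms].
    + do 3 right. left. exists j. split; [reflexivity|apply in_seq; lia].
    + left. cbn. tauto.
    + left. cbn. tauto.
    + do 5 right. exists ((pc, j), st). split; [reflexivity|].
      rewrite !in_prod_iff, !in_seq. repeat split; try lia. apply in_all_flags.
    + do 4 right. left. exists pc. split; [reflexivity|apply in_seq; lia].
    + left. cbn. tauto.
    + left. cbn. tauto.
Qed.

Lemma goto_in pc : In (goto pc) all_mstates.
Proof.
  apply in_all_mstates. unfold goto. destruct (Nat.ltb_spec pc (length code)).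
  - lia.
  - now destruct (pc =? length code).
Qed.

Lemma mdelta_in s a : In s all_mstates -> In (fst (fst (mdelta s a))) all_mstates.
Proof.
  intros H. apply in_all_mstates in H. unfold mdelta.
  destruct s, a as [c'|];
    try (cbn [fst]; first [apply goto_in | apply in_all_mstates; lia]);
    try (destruct (Nat.eqb_spec (S j) K); apply in_all_mstates; cbn [fst]; lia).
  unfold sweep_step. cbn [fst snd].
  destruct (cellop (i_op (fetch pc)) j st (Some c')) as [st' b]. cbn [fst].
  apply in_all_mstates. destruct (Nat.eqb_spec j K); lia.
Qed.

Definition sweep_tm : TM := machine mstate_dec all_mstates mdelta IFetch Accept Reject.

Local Notation cfg := (mkc mstate_dec all_mstates).
Local Notation scode := (code_state mstate_dec all_mstates).
Local Notation run := (tm_run sweep_tm).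

Lemma sweep_tm_wf : tm_wf sweep_tm.
Proof.
  apply machine_wf; try (apply in_all_mstates; exact I); try discriminate.
  exact mdelta_in.
Qed.

Ltac state_side :=
  first [ assumption | apply in_all_mstates; cbn; lia | apply in_all_mstates; exact I | discriminate
        | apply goto_in ].

Lemma run_right s l r s' b : In s all_mstates -> s <> Accept -> s <> Reject ->
  mdelta s (hd None r) = (s', b, MRight) ->
  run 1 (cfg s l r) = cfg s' (b :: l) (tl r).
Proof. intros. apply step_right; auto; state_side. Qed.

(* [z] is the blank that a previous sweep may have left behind the blocks. *)
Definition at_pc (w : list (option bool)) (pc : nat) (e : regs) (c : config) : Prop :=
  if pc <? length code then
    exists l z, (z = [] \/ z = [None]) /\
      c = cfg (Sweep pc 0 flags0) (None :: l) (tape K 0 w e ++ z)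
  else c_state c = scode (goto pc).

Lemma at_pc_goto w pc e l z : z = [] \/ z = [None] ->
  at_pc w pc e (cfg (goto pc) (None :: l) (tape K 0 w e ++ z)).
Proof.
  intros Hz. unfold at_pc. destruct (pc <? length code) eqn:E.
  - exists l, z. split; [assumption|]. unfold goto. now rewrite E.
  - apply mkc_state.
Qed.

Lemma goto_min pc : goto (Nat.min pc (S (length code))) = goto pc.
Proof.
  unfold goto. destruct (Nat.min_spec pc (S (length code))) as [[H ->]|[H ->]]; [reflexivity|].
  destruct (Nat.ltb_spec (S (length code)) (length code)), (Nat.ltb_spec pc (length code)),
    (Nat.eqb_spec (S (length code)) (length code)), (Nat.eqb_spec pc (length code));
    try lia; reflexivity.
Qed.

Lemma at_pc_min w pc e c :
  at_pc w (Nat.min pc (S (length code))) e c -> at_pc w pc e c.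
Proof.
  destruct (Nat.min_spec pc (S (length code))) as [[H E]|[H E]]; rewrite E; [auto|].
  unfold at_pc. rewrite <- E, goto_min. rewrite E.
  destruct (Nat.ltb_spec (S (length code)) (length code)), (Nat.ltb_spec pc (length code));
    try lia; auto.
Qed.

(** ** One instruction *)

(** [n * S K] cells to the right, the turn and as many cells back to the left blank, and one step
    off that blank. *)
Definition icost (n : nat) : nat := 2 * (n * S K) + 2.

(** For an operation that is not a test the flag [b] is left open: compiled code gives such an
    instruction two equal targets. *)
Lemma run_instr w pc e c : pc < length code -> op_ok K (i_op (fetch pc)) ->
  at_pc w pc e c -> exists b,
  (is_test (i_op (fetch pc)) = true -> b = op_test (i_op (fetch pc)) w e) /\
  at_pc w (if b then i_true (fetch pc) else i_false (fetch pc))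
    (op_regs (i_op (fetch pc)) e) (run (icost (length w)) c).
Proof.
  intros Hpc Hop H. unfold at_pc in H.
  destruct (Nat.ltb_spec pc (length code)) as [_|]; [|lia].
  destruct H as (l & z & Hz & ->).
  destruct (sweep_op K _ w e Hop) as (st' & Htr & Hfl).
  set (o := i_op (fetch pc)) in *. set (e' := op_regs o e) in *.
  exists (fst (fst st')). split; [assumption|].
  pose (wrap := fun x : nat * flags => Sweep pc (fst x) (snd x)).
  pose (ok := fun x : nat * flags => fst x <= K).
  assert (S1 := scan_right mstate_dec all_mstates mdelta IFetch Accept Reject
    ltac:(state_side) ltac:(state_side) wrap (sweep_step K o) ok).
  destruct (S1 ltac:(unfold ok, wrap; intros x Hx; repeat split; try state_side;
                     apply in_all_mstates; lia)) with
    (u := tape K 0 w e) (x := (0, flags0)) (l := None :: l) (r := z)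
    (z := (0, st')) (v := tape K 0 w e') as [E1 _].
  - unfold ok, wrap. intros [j st] a Hj Ha. cbn [fst snd] in *.
    destruct a as [c|]; [|congruence]. unfold mdelta. fold o.
    destruct (sweep_step K o (j, st) (Some c)) as [[j' st''] b] eqn:E. cbn [fst snd].
    split; [|reflexivity]. unfold sweep_step in E. cbn [fst snd] in E.
    destruct (cellop o j st (Some c)). injection E as <- _ _.
    destruct (Nat.eqb_spec j K); lia.
  - apply Nat.le_0_l.
  - apply tape_nonblank.
  - assumption.
  - cbn [wrap fst snd] in E1.
    replace (icost (length w))
      with (length (tape K 0 w e) + (S (length (rev (tape K 0 w e'))) + 1))
      by (rewrite length_rev, !tape_length; unfold icost; lia).
    rewrite tm_run_add. unfold sweep_tm. unfold wrap in E1. cbn [fst snd] in E1.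
    rewrite E1.
    set (pc' := Nat.min (if fst (fst st') then i_true (fetch pc) else i_false (fetch pc))
                        (S (length code))).
    assert (Hpc' : In (Return pc') all_mstates)
      by (apply in_all_mstates; unfold pc'; lia).
    rewrite tm_run_add, turn_left with (s' := Return pc') (b := None); try state_side.
    + rewrite rev_involutive.
      fold sweep_tm. rewrite run_right with (s' := goto pc') (b := None); try state_side.
      * cbn [tl]. apply at_pc_min. fold pc'.
        apply at_pc_goto. right. now destruct Hz as [-> | ->].
      * reflexivity.
    + intros [a|] Ha; [reflexivity|congruence].
    + destruct Hz as [-> | ->]; reflexivity.
    + apply Forall_rev, tape_nonblank.
Qed.

(** ** Initialisation *)

Lemma run_marks k j l : j + k < K ->
  run k (cfg (IMark j) l []) = cfg (IMark (j + k)) (repeat (bsym false) k ++ l) [].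
Proof.
  revert j l. induction k as [|k IH]; intros j l H.
  - now rewrite Nat.add_0_r.
  - change (S k) with (1 + k) at 1.
    rewrite tm_run_add, run_right with (s' := IMark (S j)) (b := bsym false); try state_side.
    + cbn [tl]. rewrite IH by lia. f_equal; [f_equal; lia|].
      change (bsym false :: l) with ([bsym false] ++ l).
      now rewrite app_assoc, <- repeat_cons.
    + unfold mdelta. destruct (Nat.eqb_spec (S j) K); [lia|reflexivity].
Qed.

Definition fresh (w : list (option bool)) : list sym :=
  flat_map (fun c => Some c :: repeat (bsym false) K) w.

(** Blocks without marks represent registers that all point past the end; hence the initial value
    [length w] of every register. *)
Lemma fresh_tape w : fresh w = tape K 0 w (fun _ => length w).
Proof.
  assert (H : forall v p n, p + length v <= n -> fresh v = tape K p v (fun _ => n)).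
  { induction v as [|c v IH]; intros p n Hn; [reflexivity|].
    cbn [fresh flat_map tape length] in *. fold (fresh v). rewrite (IH (S p) n) by lia.
    f_equal. f_equal. unfold marks.
    assert (M : forall k i, repeat (bsym false) k = map (fun _ => bsym (n =? p)) (seq i k)).
    { replace (n =? p) with false by (symmetry; apply Nat.eqb_neq; lia).
      induction k as [|k IHk]; intros i; cbn; [reflexivity|]. now rewrite <- IHk. }
    apply M. }
  apply H. lia.
Qed.

Lemma fresh_length w : length (fresh w) = length w * S K.
Proof. rewrite fresh_tape. apply tape_length. Qed.

Lemma fresh_nonblank w : Forall (fun a : sym => a <> None) (fresh w).
Proof. rewrite fresh_tape. apply tape_nonblank. Qed.

Lemma scan_copy s (u l r : list sym) :
  In s all_mstates -> s <> Accept -> s <> Reject ->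
  (forall a : sym, a <> None -> mdelta s a = (s, a, MRight)) ->
  Forall (fun a : sym => a <> None) u ->
  run (length u) (cfg s l (u ++ r)) = cfg s (rev u ++ l) r.
Proof.
  intros Hs Ha Hr Hd Hu.
  apply (scan_right mstate_dec all_mstates mdelta IFetch Accept Reject
    ltac:(state_side) ltac:(state_side) (fun _ : unit => s) (fun x a => (x, a)) (fun _ => True))
    with (x := tt) (z := tt); auto.
  clear. induction u as [|a u IH]; cbn; [reflexivity|]. now rewrite IH.
Qed.

(** The second form of [z] is the first round, in which neither the delimiting blank nor any block
    exists and the unwritten tape supplies the blank. *)
Lemma run_fetch c (w v : list (option bool)) (l z : list sym) :
  z = None :: fresh v \/ z = [] /\ v = [] ->
  run (2 * length w + 2 * (length v * S K) + 2 * K + 5)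
      (cfg IFetch l (Some c :: map Some w ++ z))
  = cfg IFetch (None :: l) (map Some w ++ None :: fresh (v ++ [c])).
Proof.
  intros Hz. set (u := map Some w : list sym).
  assert (Hu : Forall (fun a : sym => a <> None) u).
  { apply Forall_map, Forall_forall. discriminate. }
  (* In order: erase the symbol, cross the rest of the input, the blank and the blocks, append the
     symbol, write all marks but one, write the last mark and return to the blank, return over the
     input, step onto its next symbol. *)
  replace (2 * length w + 2 * (length v * S K) + 2 * K + 5)
    with (1 + (length u + (1 + (length (fresh v) + (1 + (pred K +
         (S (length (repeat (bsym false) (pred K) ++ Some c :: rev (fresh v)))
          + (S (length (rev u)) + 1))))))))
    by (rewrite length_app, repeat_length; cbn [length];
        rewrite !length_rev, fresh_length; unfold u; rewrite length_map; lia).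
  rewrite tm_run_add, run_right with (s' := ICopy c) (b := None);
    [|state_side..|reflexivity].
  rewrite tm_run_add. cbn [tl]. rewrite scan_copy;
    [|state_side..|intros [a|] Ha; [reflexivity|congruence]|assumption].
  assert (Ez : forall s L, cfg s L z = cfg s L (None :: fresh v))
    by (intros s L; destruct Hz as [-> | [-> ->]]; reflexivity).
  rewrite Ez.
  rewrite tm_run_add, run_right with (s' := IAppend c) (b := None);
    [|state_side..|reflexivity].
  rewrite tm_run_add. cbn [tl].
  assert (Ef : forall s L, cfg s L (fresh v) = cfg s L (fresh v ++ []))
    by (intros; now rewrite app_nil_r).
  rewrite Ef.
  rewrite scan_copy; [|state_side..|intros [a|] Ha; [reflexivity|congruence]
                      |apply fresh_nonblank].
  rewrite tm_run_add, run_right with (s' := IMark 0) (b := Some c);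
    [|state_side..|reflexivity].
  rewrite tm_run_add. cbn [tl]. rewrite run_marks by lia. change (0 + pred K) with (pred K).
  rewrite tm_run_add.
  change (Some c :: rev (fresh v) ++ None :: rev u ++ None :: l)
    with ((Some c :: rev (fresh v)) ++ None :: rev u ++ None :: l).
  rewrite app_assoc. unfold sweep_tm.
  rewrite turn_left with (s' := IBack) (b := bsym false);
    [|state_side..|intros [a|] Ha; [reflexivity|congruence]| |].
  - rewrite tm_run_add, turn_left with (s' := IBack2) (b := None);
      [|state_side..|intros [a|] Ha; [reflexivity|congruence]|reflexivity|].
    + fold sweep_tm. rewrite run_right with (s' := IFetch) (b := None);
        [|state_side..|reflexivity].
      cbn [tl]. rewrite rev_involutive. f_equal. f_equal. f_equal.
      rewrite rev_app_distr. cbn [rev]. rewrite rev_involutive, <- !app_assoc.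
      unfold fresh at 2. rewrite flat_map_app. fold (fresh v). f_equal. cbn. f_equal.
      rewrite app_nil_r.
      assert (R : forall n (a : sym), rev (repeat a n) ++ [a] = repeat a (S n)).
      { intros n a. assert (Rn : rev (repeat a n) = repeat a n).
        { induction n as [|n IH]; [reflexivity|].
          cbn [repeat rev]. rewrite IH. symmetry. apply repeat_cons. }
        rewrite Rn. symmetry. apply repeat_cons. }
      rewrite R. f_equal. lia.
    + now apply Forall_rev.
  - unfold mdelta. destruct (Nat.eqb_spec (S (pred K)) K); [reflexivity|lia].
  - apply Forall_app. split.
    + apply Forall_forall. intros a Ha. apply repeat_spec in Ha. subst a. discriminate.
    + constructor; [discriminate|]. apply Forall_rev, fresh_nonblank.
Qed.

Definition init_cost (n : nat) : nat := n * (2 * n + 2 * (n * S K) + 2 * K + 5) + 1.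

Lemma run_init w : exists t, t <= init_cost (length w) /\
  at_pc w 0 (fun _ => length w) (run t (tm_init sweep_tm w)).
Proof.
  assert (H : forall u v (l z : list sym), length v + length u <= length w ->
    z = None :: fresh v \/ z = [] /\ v = [] ->
    exists t l', t <= length u * (2 * length w + 2 * (length w * S K) + 2 * K + 5) + 1 /\
      run t (cfg IFetch l (map Some u ++ z)) = cfg (goto 0) (None :: l') (fresh (v ++ u))).
  { induction u as [|c u IH]; intros v l z Hl Hz.
    - exists 1, l. split; [lia|]. cbn [map app].
      assert (Ez : forall s L, cfg s L z = cfg s L (None :: fresh v))
        by (intros s L; destruct Hz as [-> | [-> ->]]; reflexivity).
      rewrite Ez.
      rewrite run_right with (s' := goto 0) (b := None); [|state_side..|reflexivity].
      now rewrite app_nil_r.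
    - cbn [map app length] in *.
      destruct (IH (v ++ [c]) (None :: l) (None :: fresh (v ++ [c]))) as (t & l' & Ht & E).
      + rewrite length_app. cbn. lia.
      + now left.
      + exists ((2 * length u + 2 * (length v * S K) + 2 * K + 5) + t), l'.
        rewrite <- app_assoc in E. split.
        * assert (length v * S K <= length w * S K) by (apply Nat.mul_le_mono_r; lia). lia.
        * now rewrite tm_run_add, (run_fetch c u v l z Hz). }
  destruct (H w [] [] []) as (t & l' & Ht & E); [cbn; lia|now right|].
  rewrite app_nil_r in E. exists t. split; [exact Ht|].
  unfold sweep_tm at 2. rewrite tm_init_mkc. rewrite E. cbn [app].
  rewrite <- (app_nil_r (fresh w)), fresh_tape. apply at_pc_goto. now left.
Qed.
End SweepMachine.

(** * First-order formulas over the positions of a string *)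

Inductive form : Type :=
| FSym (a : option bool) (i : nat)
| FDfa (q : pstate) (i : nat)
| FPlus (i j k : nat)
| FNot (f : form) | FAnd (f g : form) | FEx (f : form).

Definition scons (p : nat) (e : nat -> nat) : nat -> nat :=
  fun i => match i with 0 => p | S i' => e i' end.

Fixpoint evalb (w : list (option bool)) (e : nat -> nat) (f : form) : bool :=
  match f with
  | FSym a i => op_test (OSym a i) w e
  | FDfa q i => op_test (ODfa q i) w e
  | FPlus i j k => (e i + e j =? e k) && (e k <? length w)
  | FNot f => negb (evalb w e f)
  | FAnd f g => evalb w e f && evalb w e g
  | FEx f => existsb (fun p => evalb w (scons p e) f) (seq 0 (length w))
  end.

Lemma evalb_ext w f : forall e e', (forall i, e i = e' i) -> evalb w e f = evalb w e' f.
Proof.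
  induction f; intros e e' H; cbn; rewrite ?H; auto.
  - now rewrite (IHf e e').
  - now rewrite (IHf1 e e'), (IHf2 e e').
  - induction (seq 0 (length w)) as [|p l IH]; cbn; [reflexivity|].
    rewrite IH. f_equal. apply IHf. intros [|i]; cbn; auto.
Qed.

Fixpoint fdepth (f : form) : nat :=
  match f with
  | FNot f => fdepth f | FAnd f g => Nat.max (fdepth f) (fdepth g)
  | FEx f => S (fdepth f) | _ => 0
  end.

Fixpoint fsize (f : form) : nat :=
  match f with
  | FPlus _ _ _ => 7 | FNot f => fsize f | FAnd f g => fsize f + fsize g
  | FEx f => 3 + fsize f | _ => 1
  end.

(* Variable [i] lives in register [r i < d]; registers [x] and [S x] are scratch. *)
Fixpoint compile (x d : nat) (r : nat -> nat) (f : form) (s t u : nat) : list instr :=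
  match f with
  | FSym a i => [Build_instr (OSym a (r i)) t u]
  | FDfa q i => [Build_instr (ODfa q (r i)) t u]
  | FPlus i j k =>
      [Build_instr (OCopy (r i) x) (1 + s) (1 + s);
       Build_instr (OZero (S x)) (2 + s) (2 + s);
       Build_instr (OEq (r j) (S x)) (3 + s) (4 + s);
       Build_instr (OEq (r k) x) t u;
       Build_instr (OEq (S x) (S x)) (5 + s) u;
       Build_instr (OInc x) (6 + s) (6 + s);
       Build_instr (OInc (S x)) (2 + s) (2 + s)]
  | FNot f => compile x d r f s u t
  | FAnd f g => compile x d r f s (fsize f + s) u ++ compile x d r g (fsize f + s) t u
  | FEx f =>
      [Build_instr (OZero d) (1 + s) (1 + s);
       Build_instr (OEq d d) (3 + s) u;
       Build_instr (OInc d) (1 + s) (1 + s)]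
      ++ compile x (S d) (scons d r) f (3 + s) t (2 + s)
  end.

Lemma compile_length x d r f s t u : length (compile x d r f s t u) = fsize f.
Proof.
  revert d r s t u. induction f; intros; cbn; auto.
  rewrite length_app, IHf1, IHf2. reflexivity.
Qed.

(** In [FPlus], two instructions initialise the scratch registers and each of at most [S n] rounds
    executes at most four; in [FEx], a round costs a test, an increment and the body. *)
Fixpoint ftime (I n : nat) (f : form) : nat :=
  match f with
  | FPlus _ _ _ => 2 * I + S n * (4 * I)
  | FNot f => ftime I n f
  | FAnd f g => ftime I n f + ftime I n g
  | FEx f => I + S n * (2 * I + ftime I n f)
  | _ => I
  end.

Section Execution.
Variables (x : nat) (code : list instr) (w : list (option bool)).
Let K := S (S x).
Let n := length w.
Let I := icost K n.

Definition goes (t pc : nat) (e : regs) (pc' : nat) (e' : regs) : Prop :=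
  forall c, at_pc K code w pc e c ->
  exists t', t' <= t /\ at_pc K code w pc' e' (tm_run (sweep_tm K code) t' c).

Lemma goes_trans t t' t'' pc e pc' e' pc'' e'' :
  goes t pc e pc' e' -> goes t' pc' e' pc'' e'' -> t + t' <= t'' ->
  goes t'' pc e pc'' e''.
Proof.
  intros H H' L c Hc. destruct (H c Hc) as (u & Hu & Hc'). destruct (H' _ Hc') as (v & Hv & Hc'').
  exists (u + v). split; [lia|]. now rewrite tm_run_add.
Qed.

Lemma goes_mono t t' pc e pc' e' : t <= t' -> goes t pc e pc' e' -> goes t' pc e pc' e'.
Proof. intros L H c Hc. destruct (H c Hc) as (u & Hu & Hc'). exists u. split; [lia|assumption]. Qed.

Lemma goes_test pc e i : nth_error code pc = Some i -> op_ok K (i_op i) ->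
  is_test (i_op i) = true ->
  goes I pc e (if op_test (i_op i) w e then i_true i else i_false i) e.
Proof.
  intros E Hok Ht c Hc.
  assert (Ei : fetch code pc = i) by now apply nth_error_nth.
  assert (Hpc : pc < length code) by (apply nth_error_Some; congruence).
  destruct (run_instr K code ltac:(lia) w pc e c) as (b & Hb & H); try assumption.
  { now rewrite Ei. }
  rewrite Ei in Hb, H. rewrite <- (Hb Ht). exists I. split; [lia|].
  now destruct (i_op i).
Qed.

Lemma goes_op pc e o pc' : nth_error code pc = Some (Build_instr o pc' pc') -> op_ok K o ->
  goes I pc e pc' (op_regs o e).
Proof.
  intros E Hok c Hc.
  assert (Ei : fetch code pc = Build_instr o pc' pc') by now apply nth_error_nth.
  assert (Hpc : pc < length code) by (apply nth_error_Some; congruence).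
  destruct (run_instr K code ltac:(lia) w pc e c) as (b & _ & H); try assumption.
  { now rewrite Ei. }
  rewrite Ei in H. exists I. split; [lia|]. now destruct b.
Qed.

Definition code_at (s : nat) (l : list instr) : Prop :=
  forall k i, nth_error l k = Some i -> nth_error code (k + s) = Some i.

Lemma code_at_app s l l' : code_at s (l ++ l') -> code_at s l /\ code_at (length l + s) l'.
Proof.
  intros H. split; intros k i E.
  - apply H. rewrite nth_error_app1; [assumption|]. apply nth_error_Some. congruence.
  - rewrite Nat.add_assoc. apply H. rewrite nth_error_app2 by lia.
    now replace (k + length l - length l) with k by lia.
Qed.

Lemma upd_same e i p : upd e i p i = p.
Proof. unfold upd. now rewrite Nat.eqb_refl. Qed.

Lemma upd_other e i p j : j <> i -> upd e i p j = e j.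
Proof. intros H. unfold upd. now destruct (Nat.eqb_spec j i). Qed.

(** Only the registers below [d] are preserved: a subformula may overwrite the registers of its own
    quantifiers and the scratch registers, which [d + fdepth f <= x] keeps apart. *)
Lemma run_form f : forall d r s t u e,
  (forall i, r i < d) -> d + fdepth f <= x ->
  code_at s (compile x d r f s t u) ->
  exists e', goes (ftime I n f) s e (if evalb w (fun i => e (r i)) f then t else u) e' /\
    forall j, j < d -> e' j = e j.
Proof.
  induction f as [a i|q i|i j k|f IH|f IHf g IHg|f IH]; intros d r s t u e Hr Hd Hc.
  - exists e. split; [|auto]. specialize (Hr i). cbn in Hd.
    apply (goes_test s e _ (Hc 0 _ eq_refl)); [cbn; lia|reflexivity].
  - exists e. split; [|auto]. specialize (Hr i). cbn in Hd.
    apply (goes_test s e _ (Hc 0 _ eq_refl)); [cbn; lia|reflexivity].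
  - cbn in Hd. pose proof (Hr i) as Hi. pose proof (Hr j) as Hj. pose proof (Hr k) as Hk.
    (* Register [S x] counts the rounds [p], and [x] holds the first summand plus [p]. The loop
       stops when [p] reaches the second summand or leaves the word; in the latter case the sum lies
       outside the word too. *)
    assert (Loop : forall m p e1, n - p <= m -> p <= e (r j) ->
      (forall h, h < d -> e1 h = e h) -> e1 x = e (r i) + p -> e1 (S x) = p ->
      exists e', goes (S m * (4 * I)) (2 + s) e1
        (if evalb w (fun i => e (r i)) (FPlus i j k) then t else u) e' /\
        forall h, h < d -> e' h = e h).
    { induction m as [|m IHm]; intros p e1 Hm Hp H1 Hx Hy;
        pose proof (goes_test _ e1 _ (Hc 2 _ eq_refl) ltac:(cbn; lia) eq_refl) as G2;
        pose proof (goes_test _ e1 _ (Hc 3 _ eq_refl) ltac:(cbn; lia) eq_refl) as G3;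
        pose proof (goes_test _ e1 _ (Hc 4 _ eq_refl) ltac:(cbn; lia) eq_refl) as G4;
        cbn [op_test i_op i_true i_false evalb] in *; fold n; fold n in G2, G3, G4;
        rewrite ?(H1 (r j) Hj), ?(H1 (r k) Hk), ?Hx, ?Hy, ?Nat.eqb_refl in *.
      - replace (p <? n) with false in G4 by (symmetry; apply Nat.ltb_ge; lia).
        replace ((e (r j) <? n) && (e (r j) =? p)) with false in G2.
        2: { destruct (Nat.ltb_spec (e (r j)) n), (Nat.eqb_spec (e (r j)) p); cbn; lia. }
        replace ((e (r i) + e (r j) =? e (r k)) && (e (r k) <? n)) with false.
        2: { destruct (Nat.eqb_spec (e (r i) + e (r j)) (e (r k))),
               (Nat.ltb_spec (e (r k)) n); cbn; lia. }
        exists e1. split; [|auto]. cbn [andb] in G4. eapply goes_trans; [exact G2|exact G4|lia].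
      - destruct (Nat.eqb_spec (e (r j)) p) as [Ep|Np].
        + exists e1. split; [|auto].
          destruct (Nat.ltb_spec (e (r j)) n) as [L|L]; cbn [andb] in G2.
          * replace ((e (r i) + e (r j) =? e (r k)) && (e (r k) <? n))
              with ((e (r k) <? n) && (e (r k) =? e (r i) + p)).
            2: { rewrite andb_comm, Ep. f_equal. apply Nat.eqb_sym. }
            eapply goes_trans; [exact G2|exact G3|lia].
          * replace ((e (r i) + e (r j) =? e (r k)) && (e (r k) <? n)) with false.
            2: { destruct (Nat.eqb_spec (e (r i) + e (r j)) (e (r k))),
                   (Nat.ltb_spec (e (r k)) n); cbn; lia. }
            replace (p <? n) with false in G4 by (symmetry; apply Nat.ltb_ge; lia).
            cbn [andb] in G4. eapply goes_trans; [exact G2|exact G4|lia].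
        + rewrite andb_false_r in G2. cbn [andb] in G2.
          destruct (Nat.ltb_spec p n) as [L|L]; cbn [andb] in G4.
          * pose proof (goes_op _ e1 _ _ (Hc 5 _ eq_refl) ltac:(cbn; lia)) as G5.
            cbn [op_regs] in G5. set (e2 := upd e1 x (S (e1 x))) in *.
            pose proof (goes_op _ e2 _ _ (Hc 6 _ eq_refl) ltac:(cbn; lia)) as G6.
            cbn [op_regs] in G6. set (e3 := upd e2 (S x) (S (e2 (S x)))) in *.
            destruct (IHm (S p) e3) as (e' & G7 & He').
            -- lia.
            -- lia.
            -- intros h Hh. unfold e3, e2. rewrite !upd_other by lia. auto.
            -- unfold e3. rewrite upd_other by lia. unfold e2. rewrite upd_same. lia.
            -- unfold e3. rewrite upd_same. unfold e2. rewrite upd_other by lia. now rewrite Hy.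
            -- exists e'. split; [|assumption].
               assert (GA : goes (2 * I) (2 + s) e1 (5 + s) e1)
                 by (eapply goes_trans; [exact G2|exact G4|lia]).
               assert (GB : goes (2 * I) (5 + s) e1 (2 + s) e3)
                 by (eapply goes_trans; [exact G5|exact G6|lia]).
               assert (GC : goes (4 * I) (2 + s) e1 (2 + s) e3)
                 by (eapply goes_trans; [exact GA|exact GB|lia]).
               eapply goes_trans; [exact GC|exact G7|lia].
          * replace ((e (r i) + e (r j) =? e (r k)) && (e (r k) <? n)) with false.
            2: { destruct (Nat.eqb_spec (e (r i) + e (r j)) (e (r k))),
                   (Nat.ltb_spec (e (r k)) n); cbn; lia. }
            exists e1. split; [|auto]. eapply goes_trans; [exact G2|exact G4|lia]. }
    pose proof (goes_op _ e _ _ (Hc 0 _ eq_refl) ltac:(cbn; lia)) as G0.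
    cbn [op_regs] in G0. set (e1 := upd e x (e (r i))) in *.
    pose proof (goes_op _ e1 _ _ (Hc 1 _ eq_refl) ltac:(cbn; lia)) as G1.
    cbn [op_regs] in G1. set (e2 := upd e1 (S x) 0) in *.
    destruct (Loop n 0 e2) as (e' & G2 & He'); try lia.
    + intros h Hh. unfold e2, e1. now rewrite !upd_other by lia.
    + unfold e2. rewrite upd_other by lia. unfold e1. rewrite upd_same. lia.
    + apply upd_same.
    + exists e'. split; [|assumption]. cbn [ftime].
      assert (GA : goes (2 * I) s e (2 + s) e2)
        by (eapply goes_trans; [exact G0|exact G1|lia]).
      eapply goes_trans; [exact GA|exact G2|lia].
  - destruct (IH d r s u t e Hr Hd Hc) as (e' & G & He'). exists e'. split; [|assumption].
    cbn [evalb ftime]. now destruct (evalb w (fun i => e (r i)) f).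
  - cbn [fdepth compile] in *. apply code_at_app in Hc. rewrite compile_length in Hc.
    destruct Hc as [Hc1 Hc2].
    destruct (IHf d r s _ u e Hr ltac:(lia) Hc1) as (e1 & G1 & He1).
    destruct (IHg d r _ t u e1 Hr ltac:(lia) Hc2) as (e2 & G2 & He2).
    cbn [evalb ftime]. destruct (evalb w (fun i => e (r i)) f); cbn [andb].
    + exists e2. split; [|intros j Hj; now rewrite He2, He1].
      rewrite (evalb_ext w g _ (fun i => e (r i))) in G2 by auto.
      eapply goes_trans; [exact G1|exact G2|lia].
    + exists e1. split; [|assumption]. eapply goes_mono; [|exact G1]. lia.
  - cbn [fdepth compile] in *. apply code_at_app in Hc. destruct Hc as [Hc Hcf].
    cbn [length] in Hcf.
    assert (Hr' : forall i, scons d r i < S d).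
    { intros [|i]; cbn; [lia|]. specialize (Hr i). lia. }
    (* Register [d] enumerates the candidate positions; [p] is the next one and [m] the number of
       those left. *)
    assert (Loop : forall m p e1, n - p = m -> p <= n ->
      (forall h, h < d -> e1 h = e h) -> e1 d = p ->
      exists e', goes (I + m * (2 * I + ftime I n f)) (1 + s) e1
        (if existsb (fun p => evalb w (scons p (fun i => e (r i))) f) (seq p m) then t else u) e' /\
        forall h, h < d -> e' h = e h).
    { induction m as [|m IHm]; intros p e1 Hm Hp H1 Ed;
        pose proof (goes_test _ e1 _ (Hc 1 _ eq_refl) ltac:(cbn; lia) eq_refl) as G1;
        cbn [op_test i_op i_true i_false] in G1; fold n in G1;
        rewrite Ed, Nat.eqb_refl, andb_true_r in G1.
      - replace (p <? n) with false in G1 by (symmetry; apply Nat.ltb_ge; lia).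
        exists e1. split; [|assumption]. cbn [existsb seq]. rewrite Nat.mul_0_l.
        eapply goes_mono; [|exact G1]. lia.
      - replace (p <? n) with true in G1 by (symmetry; apply Nat.ltb_lt; lia).
        destruct (IH (S d) (scons d r) _ t (2 + s) e1 Hr' ltac:(lia) Hcf) as (e2 & G2 & He2).
        rewrite (evalb_ext w f _ (scons p (fun i => e (r i)))) in G2
          by (intros [|i]; cbn; auto).
        cbn [seq existsb]. destruct (evalb w (scons p (fun i => e (r i))) f); cbn [orb].
        + exists e2. split; [|intros h Hh; rewrite He2 by lia; auto].
          eapply goes_trans; [exact G1|exact G2|lia].
        + pose proof (goes_op _ e2 _ _ (Hc 2 _ eq_refl) ltac:(cbn; lia)) as G3.
          cbn [op_regs] in G3. set (e3 := upd e2 d (S (e2 d))) in *.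
          destruct (IHm (S p) e3) as (e' & G4 & He').
          * lia.
          * lia.
          * intros h Hh. unfold e3. rewrite upd_other, He2 by lia. auto.
          * unfold e3. rewrite upd_same, He2 by lia. now rewrite Ed.
          * exists e'. split; [|assumption].
            assert (GA : goes (I + ftime I n f) (1 + s) e1 (2 + s) e2)
              by (eapply goes_trans; [exact G1|exact G2|lia]).
            assert (GB : goes (2 * I + ftime I n f) (1 + s) e1 (1 + s) e3)
              by (eapply goes_trans; [exact GA|exact G3|lia]).
            eapply goes_trans; [exact GB|exact G4|lia]. }
    pose proof (goes_op _ e _ _ (Hc 0 _ eq_refl) ltac:(cbn; lia)) as G0.
    cbn [op_regs] in G0. set (e1 := upd e d 0) in *.
    destruct (Loop n 0 e1) as (e' & G1 & He'); try lia.
    + intros h Hh. unfold e1. now rewrite upd_other by lia.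
    + apply upd_same.
    + exists e'. split; [|assumption]. cbn [evalb ftime].
      eapply goes_trans; [exact G0|exact G1|lia].
Qed.
End Execution.

(** ** Polynomial bounds *)

(** Powers of [S n] are at least 1 even at [n = 0], so sums and products of bounds need no special
    case; [poly_bound_of] converts to the official form. *)
Definition poly_bounded (f : nat -> nat) : Prop :=
  exists c k, forall n, f n <= c * S n ^ k.

Lemma poly_const c : poly_bounded (fun _ => c).
Proof. exists c, 0. intros n. cbn. lia. Qed.

Lemma poly_id : poly_bounded (fun n => n).
Proof. exists 1, 1. intros n. cbn. lia. Qed.

Lemma poly_add f g : poly_bounded f -> poly_bounded g -> poly_bounded (fun n => f n + g n).
Proof.
  intros (c & k & H) (c' & k' & H'). exists (c + c'), (k + k'). intros n.
  specialize (H n). specialize (H' n). rewrite Nat.pow_add_r.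
  assert (1 <= S n ^ k /\ 1 <= S n ^ k') by (split; apply Nat.neq_0_lt_0, Nat.pow_nonzero; lia).
  nia.
Qed.

Lemma poly_mul f g : poly_bounded f -> poly_bounded g -> poly_bounded (fun n => f n * g n).
Proof.
  intros (c & k & H) (c' & k' & H'). exists (c * c'), (k + k'). intros n.
  rewrite Nat.pow_add_r. transitivity ((c * S n ^ k) * (c' * S n ^ k')).
  - now apply Nat.mul_le_mono.
  - apply Nat.eq_le_incl. ring.
Qed.

Lemma poly_bound_of f : poly_bounded f -> exists k, forall n, f n <= poly_bound k n.
Proof.
  (* For positive [n], [S n <= 2 * n] yields the factor [2 ^ k], and the summand [k] makes the
     exponent large enough; at [n = 0] the additive term of [poly_bound] is at least [c]. *)
  intros (c & k & H). exists (c * 2 ^ k + k). intros n. specialize (H n). unfold poly_bound.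
  set (m := c * 2 ^ k + k). destruct (Nat.eq_dec n 0) as [->|Hn].
  - rewrite Nat.pow_1_l in H.
    assert (1 <= 2 ^ k) by (apply Nat.neq_0_lt_0, Nat.pow_nonzero; lia).
    assert (c <= m) by (unfold m; nia). lia.
  - assert (E : S n ^ k <= 2 ^ k * n ^ k).
    { rewrite <- Nat.pow_mul_l. apply Nat.pow_le_mono_l. lia. }
    assert (E' : n ^ k <= n ^ m) by (apply Nat.pow_le_mono_r; unfold m; lia).
    transitivity (c * (2 ^ k * n ^ k)).
    { etransitivity; [exact H|]. apply Nat.mul_le_mono_l. exact E. }
    rewrite Nat.mul_assoc. transitivity (m * n ^ m); [|lia].
    apply Nat.mul_le_mono; [unfold m; lia|assumption].
Qed.

Lemma poly_ftime K f : poly_bounded (fun n => ftime (icost K n) n f).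
Proof.
  assert (PI : poly_bounded (icost K)).
  { apply (poly_add (fun n => 2 * (n * S K)) (fun _ => 2));
      repeat first [apply poly_const | apply poly_id | apply poly_mul]. }
  assert (PS : poly_bounded S).
  { apply (poly_add (fun _ => 1) (fun n => n)); [apply poly_const|apply poly_id]. }
  induction f; cbn [ftime];
    repeat first [assumption | apply poly_const | apply poly_id | apply poly_add | apply poly_mul].
Qed.

Lemma poly_init_cost K : poly_bounded (init_cost K).
Proof.
  unfold init_cost.
  repeat first [apply poly_const | apply poly_id | apply poly_add | apply poly_mul].
Qed.

(** Truth leads to address [fsize f], the end of the program, and falsity to the address after it.
    All free variables share register 0, which is never moved and points past the end. *)
Theorem form_in_P f : in_P (fun w => evalb w (fun _ => length w) f = true).
Proof.
  set (x := S (fdepth f)). set (K := S (S x)).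
  set (code := compile x 1 (fun _ => 0) f 0 (fsize f) (S (fsize f))).
  destruct (poly_bound_of (fun n => init_cost K n + ftime (icost K n) n f)) as [k Hk].
  { apply (poly_add (init_cost K) (fun n => ftime (icost K n) n f));
      [apply poly_init_cost|apply poly_ftime]. }
  assert (HK : 0 < K) by (unfold K; lia).
  exists (sweep_tm K code), k. split; [now apply sweep_tm_wf|].
  intros w. cbn zeta. set (n := length w) in *.
  destruct (run_init K code HK w) as (t0 & Ht0 & H0). fold n in Ht0, H0.
  destruct (run_form x code w f 1 (fun _ => 0) 0 (fsize f) (S (fsize f)) (fun _ => n))
    as (e' & G & _).
  { lia. } { unfold x. lia. } { intros j i E. now rewrite Nat.add_0_r. }
  destruct (G _ H0) as (t1 & Ht1 & H1). fold K n in Ht1. clear G.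
  rewrite <- tm_run_add in H1. specialize (Hk n).
  set (res := evalb w (fun _ => n) f) in *.
  assert (L : length code = fsize f) by apply compile_length.
  assert (H2 : c_state (tm_run (sweep_tm K code) (t0 + t1) (tm_init (sweep_tm K code) w))
               = if res then tm_acc (sweep_tm K code) else tm_rej (sweep_tm K code)).
  { unfold at_pc in H1. rewrite L in H1. unfold goto in H1. rewrite L in H1.
    destruct res.
    - now rewrite Nat.ltb_irrefl, Nat.eqb_refl in H1.
    - replace (S (fsize f) <? fsize f) with false in H1 by (symmetry; apply Nat.ltb_ge; lia).
      replace (S (fsize f) =? fsize f) with false in H1 by (symmetry; apply Nat.eqb_neq; lia).
      assumption. }
  replace (poly_bound k n) with ((t0 + t1) + (poly_bound k n - (t0 + t1))) by lia.
  rewrite tm_run_add, tm_run_halted by (rewrite H2; destruct res; tauto).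
  rewrite H2. destruct (sweep_tm_wf K code HK) as (_ & _ & _ & Hne & _).
  destruct res; split; try tauto; split; congruence.
Qed.

(** * Definable relations between positions *)

Definition word : Type := list (option bool).

(** Definability is handled through closure properties of relations, so that the formula of the
    verifier never has to be written out. *)
Definition FO (R : word -> (nat -> nat) -> Prop) : Prop :=
  exists f, forall w e, evalb w e f = true <-> R w e.

Lemma FO_ext (R R' : word -> (nat -> nat) -> Prop) :
  (forall w e, R w e <-> R' w e) -> FO R -> FO R'.
Proof. intros H [f Hf]. exists f. intros w e. now rewrite Hf. Qed.

Lemma FO_not (R : word -> (nat -> nat) -> Prop) : FO R -> FO (fun w e => ~ R w e).
Proof.
  intros [f Hf]. exists (FNot f). intros w e. cbn. rewrite <- Hf.
  destruct (evalb w e f); cbn; split; congruence.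
Qed.

Lemma FO_and (R R' : word -> (nat -> nat) -> Prop) :
  FO R -> FO R' -> FO (fun w e => R w e /\ R' w e).
Proof.
  intros [f Hf] [g Hg]. exists (FAnd f g). intros w e. cbn.
  rewrite andb_true_iff. now rewrite Hf, Hg.
Qed.

Lemma FO_or (R R' : word -> (nat -> nat) -> Prop) :
  FO R -> FO R' -> FO (fun w e => R w e \/ R' w e).
Proof.
  intros H H'. apply (FO_ext (fun w e => ~ (~ R w e /\ ~ R' w e))).
  - intros w e. tauto.
  - apply FO_not, FO_and; now apply FO_not.
Qed.

Lemma FO_imp (R R' : word -> (nat -> nat) -> Prop) :
  FO R -> FO R' -> FO (fun w e => R w e -> R' w e).
Proof.
  intros H H'. apply (FO_ext (fun w e => ~ R w e \/ R' w e)).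
  - intros w e. tauto.
  - apply FO_or; [now apply FO_not|assumption].
Qed.

(** [P] is the same for all words, so one of two constant formulas defines it, although no
    computation tells which. *)
Lemma FO_const (P : Prop) : FO (fun _ _ => P).
Proof.
  set (f := FSym None 0). destruct (classic P) as [H|H].
  - exists (FNot (FAnd f (FNot f))). intros w e. cbn [evalb].
    destruct (evalb w e f); cbn; tauto.
  - exists (FAnd f (FNot f)). intros w e. cbn [evalb].
    destruct (evalb w e f); cbn; split; (discriminate || tauto).
Qed.

Lemma FO_ex (R : word -> (nat -> nat) -> nat -> Prop) :
  FO (fun w e => R w (fun i => e (S i)) (e 0)) ->
  FO (fun w e => exists p, p < length w /\ R w e p).
Proof.
  intros [f Hf]. exists (FEx f). intros w e. cbn [evalb]. rewrite existsb_exists. split.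
  - intros (p & Hp & H). apply in_seq in Hp. exists p. split; [lia|]. now apply Hf in H.
  - intros (p & Hp & H). exists p. split; [apply in_seq; lia|]. now apply Hf.
Qed.

Lemma FO_all (R : word -> (nat -> nat) -> nat -> Prop) :
  FO (fun w e => R w (fun i => e (S i)) (e 0)) ->
  FO (fun w e => forall p, p < length w -> R w e p).
Proof.
  intros H. apply (FO_ext (fun w e => ~ exists p, p < length w /\ ~ R w e p)).
  - intros w e. split.
    + intros N p Hp. apply NNPP. intros N'. apply N. now exists p.
    + intros H' (p & Hp & N). auto.
  - apply FO_not, (FO_ex (fun w e p => ~ R w e p)). now apply FO_not.
Qed.

Lemma FO_Exists {A} (R : A -> word -> (nat -> nat) -> Prop) l :
  (forall x, In x l -> FO (R x)) -> FO (fun w e => Exists (fun x => R x w e) l).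
Proof.
  intros H. induction l as [|x l IH].
  - apply (FO_ext (fun _ _ => False)); [|apply FO_const].
    intros w e. split; [tauto|intros K; inversion K].
  - apply (FO_ext (fun w e => R x w e \/ Exists (fun x => R x w e) l)).
    + intros w e. now rewrite Exists_cons.
    + apply FO_or; [apply H; now left|apply IH; intros y Hy; apply H; now right].
Qed.

Lemma FO_Forall {A} (R : A -> word -> (nat -> nat) -> Prop) l :
  (forall x, In x l -> FO (R x)) -> FO (fun w e => Forall (fun x => R x w e) l).
Proof.
  intros H. induction l as [|x l IH].
  - apply (FO_ext (fun _ _ => True)); [|apply FO_const].
    intros w e. split; [constructor|tauto].
  - apply (FO_ext (fun w e => R x w e /\ Forall (fun x => R x w e) l)).
    + intros w e. now rewrite Forall_cons_iff.
    + apply FO_and; [apply H; now left|apply IH; intros y Hy; apply H; now right].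
Qed.

Create HintDb fo.

Ltac fo := cbv beta;
  first
  [ solve [eauto with fo]
  | lazymatch goal with
    | |- FO (fun w e => _ /\ _) => apply FO_and; fo
    | |- FO (fun w e => _ \/ _) => apply FO_or; fo
    | |- FO (fun w e => ~ _) => apply FO_not; fo
    | |- FO (fun w e => exists p, p < length w /\ _) => apply FO_ex; fo
    | |- FO (fun w e => forall p, p < length w -> _) => apply FO_all; fo
    | |- FO (fun w e => _ -> _) => apply FO_imp; fo
    | _ => idtac
    end ].

Definition Sym (w : word) (a : option bool) (p : nat) : Prop := nth_error w p = Some a.
Definition St (w : word) (q : pstate) (p : nat) : Prop :=
  p < length w /\ prun PDb (firstn p w) = q.
Definition Plus (w : word) (a b c : nat) : Prop := a + b = c /\ c < length w.

Lemma FO_Sym a i : FO (fun w e => Sym w a (e i)).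
Proof.
  exists (FSym a i). intros w e. cbn [evalb op_test]. unfold Sym, osym_eqb.
  destruct (Nat.ltb_spec (e i) (length w)) as [L|L]; cbn [andb].
  - rewrite (nth_error_nth' w None L).
    destruct (osym_dec (nth (e i) w None) a); split; congruence.
  - apply nth_error_None in L. rewrite L. split; discriminate.
Qed.

Lemma FO_St q i : FO (fun w e => St w q (e i)).
Proof.
  exists (FDfa q i). intros w e. cbn [evalb op_test]. unfold St, pstate_eqb.
  rewrite andb_true_iff, Nat.ltb_lt. destruct (pstate_dec _ q); intuition congruence.
Qed.

Lemma FO_Plus i j k : FO (fun w e => Plus w (e i) (e j) (e k)).
Proof.
  exists (FPlus i j k). intros w e. cbn [evalb].
  rewrite andb_true_iff, Nat.eqb_eq, Nat.ltb_lt. reflexivity.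
Qed.
#[export] Hint Resolve FO_Sym FO_St FO_Plus FO_const : fo.

(** * Order, successor and substrings from addition of positions *)

Definition Le (w : word) (a b : nat) : Prop := exists d, d < length w /\ Plus w a d b.
Definition Lt (w : word) (a b : nat) : Prop := Le w a b /\ ~ Le w b a.
Definition Succ (w : word) (a b : nat) : Prop :=
  Lt w a b /\ ~ exists c, c < length w /\ Lt w a c /\ Lt w c b.
Fixpoint Shift (w : word) (k a b : nat) : Prop :=
  match k with
  | 0 => Le w a b /\ Le w b a
  | S k => exists c, c < length w /\ Succ w a c /\ Shift w k c b
  end.

Lemma Le_iff w a b : Le w a b <-> a <= b < length w.
Proof.
  unfold Le, Plus. split.
  - intros (d & Hd & H). lia.
  - intros H. exists (b - a). lia.
Qed.

Lemma Lt_iff w a b : Lt w a b <-> a < b < length w.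
Proof. unfold Lt. rewrite !Le_iff. lia. Qed.

Lemma Succ_iff w a b : Succ w a b <-> b = S a /\ b < length w.
Proof.
  unfold Succ. setoid_rewrite Lt_iff. split.
  - intros [H N]. split; [|lia]. destruct (Nat.eq_dec b (S a)); [assumption|].
    exfalso. apply N. exists (S a). lia.
  - intros [-> H]. split; [lia|]. intros (c & Hc). lia.
Qed.

Lemma Shift_iff w k a b : Shift w k a b <-> b = k + a /\ b < length w.
Proof.
  revert a. induction k as [|k IH]; intros a; cbn [Shift].
  - rewrite !Le_iff. lia.
  - setoid_rewrite IH. setoid_rewrite Succ_iff. split.
    + intros (c & Hc). lia.
    + intros H. exists (S a). lia.
Qed.

Lemma FO_Le i j : FO (fun w e => Le w (e i) (e j)).
Proof. unfold Le. fo. Qed.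
#[export] Hint Resolve FO_Le : fo.
Lemma FO_Lt i j : FO (fun w e => Lt w (e i) (e j)).
Proof. unfold Lt. fo. Qed.
#[export] Hint Resolve FO_Lt : fo.
Lemma FO_Succ i j : FO (fun w e => Succ w (e i) (e j)).
Proof. unfold Succ. fo. Qed.
#[export] Hint Resolve FO_Succ : fo.
Lemma FO_Shift k i j : FO (fun w e => Shift w k (e i) (e j)).
Proof. revert i j. induction k as [|k IH]; intros i j; cbn [Shift]; fo. Qed.
#[export] Hint Resolve FO_Shift : fo.

(* [r <> []] ensures that the end of the occurrence of [s] is a position of [w]. *)
Definition At (w : word) (p : nat) (s : list bool) : Prop :=
  exists r, skipn p w = map Some s ++ r /\ r <> [].

Fixpoint AtStr (w : word) (s : list bool) (p : nat) : Prop :=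
  match s with
  | [] => Le w p p
  | b :: s => Sym w (Some b) p /\ exists q, q < length w /\ Succ w p q /\ AtStr w s q
  end.

Lemma FO_AtStr s i : FO (fun w e => AtStr w s (e i)).
Proof. revert i. induction s as [|b s IH]; intros i; cbn [AtStr]; fo. Qed.
#[export] Hint Resolve FO_AtStr : fo.

Lemma skipn_nonempty {A} (w : list A) p : skipn p w <> [] <-> p < length w.
Proof.
  rewrite <- length_zero_iff_nil, length_skipn. lia.
Qed.

Lemma At_app w p s t : At w p (s ++ t) <-> At w p s /\ At w (length s + p) t.
Proof.
  unfold At. rewrite map_app. split.
  - intros (r & E & Hr). split.
    + exists (map Some t ++ r). rewrite app_assoc. split; [assumption|].
      intros N. apply app_eq_nil in N. tauto.
    + exists r. split; [|assumption]. rewrite <- skipn_skipn, E, <- app_assoc.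
      rewrite skipn_app, length_map, Nat.sub_diag.
      rewrite skipn_all2 by (rewrite length_map; lia). reflexivity.
  - intros [(r & E & Hr) (r' & E' & Hr')]. exists r'. split; [|assumption].
    rewrite <- skipn_skipn, E in E'.
    rewrite skipn_app, length_map, Nat.sub_diag in E'.
    rewrite skipn_all2 in E' by (rewrite length_map; lia). cbn in E'.
    now rewrite E, E', <- app_assoc.
Qed.

Lemma At_nil w p : At w p [] <-> p < length w.
Proof.
  unfold At. rewrite <- skipn_nonempty. split.
  - intros (r & -> & Hr). exact Hr.
  - intros H. now exists (skipn p w).
Qed.

Lemma At_sym w p b : At w p [b] <-> nth_error w p = Some (Some b) /\ S p < length w.
Proof.
  split.
  - intros (r & E & Hr). split.
    + rewrite <- (firstn_skipn p w), E. rewrite nth_error_app2 by (rewrite length_firstn; lia).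
      assert (L : p < length w) by (apply skipn_nonempty; rewrite E; discriminate).
      now rewrite length_firstn, Nat.min_l, Nat.sub_diag by lia.
    + apply (f_equal (@length _)) in E. rewrite length_skipn in E. cbn in E.
      destruct r; [congruence|]. cbn in E. lia.
  - intros [E H]. apply nth_error_split in E. destruct E as (l & r & -> & <-).
    exists r. rewrite skipn_app, skipn_all, Nat.sub_diag. split; [reflexivity|].
    rewrite length_app in H. cbn in H. intros ->. cbn in H. lia.
Qed.

Lemma AtStr_iff w s p : AtStr w s p <-> At w p s.
Proof.
  revert p. induction s as [|b s IH]; intros p; cbn [AtStr].
  - rewrite At_nil, Le_iff. lia.
  - change (b :: s) with ([b] ++ s). rewrite At_app, At_sym. cbn [length plus].
    setoid_rewrite IH. setoid_rewrite Succ_iff. unfold Sym. split.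
    + intros [H (q & Hq & [-> _] & Ha)]. auto.
    + intros [[H L] Ha]. split; [assumption|]. exists (S p). auto.
Qed.

(** * Parsing encoded databases *)

Definition ob (s : list bool) : word := map Some s.

(** The remainders are arbitrary words, so the object encoded at a position is unique whatever
    follows it, separator and certificate included. *)
Definition prefix_free {A} (f : A -> list bool) : Prop :=
  forall x y r r', ob (f x) ++ r = ob (f y) ++ r' -> x = y /\ r = r'.

Lemma pos_bits_inj p p' : pos_bits p = pos_bits p' -> p = p'.
Proof.
  revert p'. induction p; intros [p'|p'|]; cbn; intros H; try discriminate; auto;
    injection H as H; now rewrite (IHp _ H).
Qed.

Lemma nat_bits_inj n m : nat_bits n = nat_bits m -> n = m.
Proof.
  unfold nat_bits. intros H.
  destruct (N.of_nat n) as [|p] eqn:En, (N.of_nat m) as [|p'] eqn:Em; try discriminate.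
  - lia.
  - injection H as H. apply pos_bits_inj in H. subst. lia.
Qed.

Lemma enc_nat_prefix_free : prefix_free enc_nat.
Proof.
  unfold enc_nat. intros n m r r' H.
  enough (nat_bits n = nat_bits m /\ r = r') by (split; [apply nat_bits_inj|]; tauto).
  revert H. generalize (nat_bits n) (nat_bits m). clear.
  induction l as [|b l IH]; intros [|b' l']; cbn; intros H; try discriminate.
  - injection H as H. auto.
  - injection H as Hb H. destruct (IH _ H). subst. auto.
Qed.

Lemma enc_list_prefix_free {A} (f : A -> list bool) : prefix_free f -> prefix_free (enc_list f).
Proof.
  unfold enc_list. intros Hf l. induction l as [|x l IH]; intros [|y l'] r r'; cbn; intros H;
    try discriminate.
  - injection H as H. auto.
  - injection H as H. unfold ob in H. rewrite !map_app, <- !app_assoc in H.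
    apply Hf in H. destruct H as [-> H]. specialize (IH l' r r').
    unfold ob in IH. rewrite !map_app, <- !app_assoc in IH. destruct (IH H). now subst.
Qed.

Lemma enc_fact_prefix_free : prefix_free enc_fact.
Proof.
  intros [p l] [p' l'] r r' H. unfold enc_fact, ob in H. cbn [fst snd] in H.
  rewrite !map_app, <- !app_assoc in H. apply enc_nat_prefix_free in H.
  destruct H as [-> H]. apply (enc_list_prefix_free _ enc_nat_prefix_free) in H.
  now destruct H as [-> ->].
Qed.

Lemma enc_db_inj D D' : enc_db D = enc_db D' -> D = D'.
Proof.
  intros H. apply (enc_list_prefix_free _ enc_fact_prefix_free D D' [] []).
  unfold enc_db in H. now rewrite H.
Qed.

Lemma prefix_free_At {A} (f : A -> list bool) w p x y :
  prefix_free f -> At w p (f x) -> At w p (f y) -> x = y.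
Proof.
  intros Hf (r & E & _) (r' & E' & _). rewrite E in E'. now apply Hf in E'.
Qed.

Lemma pos_bits_surj l : exists p, pos_bits p = l.
Proof.
  induction l as [|b l [p Hp]]; [now exists xH|].
  destruct b; [exists (xI p)|exists (xO p)]; cbn; now rewrite Hp.
Qed.

(** Every bit string that starts with 1 is the binary form of a number, so a finite automaton can
    recognise valid encodings: of the bits of a number it only has to inspect the first. *)
Lemma nat_bits_surj l : exists n, nat_bits n = true :: l.
Proof.
  destruct (pos_bits_surj l) as [p Hp]. exists (Pos.to_nat p).
  unfold nat_bits. replace (N.of_nat (Pos.to_nat p)) with (Npos p) by lia. now rewrite Hp.
Qed.

Definition enc_bits (l : list bool) : list bool := flat_map (fun b => [true; b]) l.
Definition enc_items {A} (f : A -> list bool) (l : list A) : list bool :=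
  flat_map (fun x => [false; true] ++ f x) l.

(* What remains to be read in state [q] of an accepted string. *)
Definition suffix_spec (q : pstate) (s : list bool) : Prop :=
  match q with
  | PDb => exists D, s = enc_db D
  | PDb0 => exists D, false :: s = enc_db D
  | PPred => exists f D, s = enc_fact f ++ enc_db D
  | PArg => exists n l D, s = enc_nat n ++ enc_list enc_nat l ++ enc_db D
  | PNat => exists b l D, s = enc_bits b ++ [false; false] ++ enc_list enc_nat l ++ enc_db D
  | PLead =>
      exists b l D, s = true :: enc_bits b ++ [false; false] ++ enc_list enc_nat l ++ enc_db D
  | PBit =>
      exists c b l D, s = c :: enc_bits b ++ [false; false] ++ enc_list enc_nat l ++ enc_db D
  | PEnd => exists l D, s = false :: enc_list enc_nat l ++ enc_db D
  | PArgs => exists l D, s = enc_list enc_nat l ++ enc_db D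
  | PArgs0 => exists l D, false :: s = enc_list enc_nat l ++ enc_db D
  | PDone => s = []
  | PDead => False
  end.

Lemma prun_dead w : prun PDead w = PDead.
Proof. induction w as [|c w IH]; [reflexivity|]. cbn. now destruct c as [[|]|]. Qed.

Lemma nat_start s : (exists l D, s = false :: false :: enc_list enc_nat l ++ enc_db D) \/
  (exists b l D,
     s = true :: true :: enc_bits b ++ [false; false] ++ enc_list enc_nat l ++ enc_db D) ->
  exists n l D, s = enc_nat n ++ enc_list enc_nat l ++ enc_db D.
Proof.
  intros [(l & D & ->)|(b & l & D & ->)].
  - now exists 0, l, D.
  - destruct (nat_bits_surj b) as [n Hn]. exists n, l, D. unfold enc_nat. rewrite Hn.
    fold (enc_bits b). cbn. now rewrite <- app_assoc.
Qed.

(** From [PDb], an accepted string is seen to encode a database; from [PPred] or [PArg], the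
    statement yields the fact or number that begins at the current position. *)
Lemma suffix_parse s : forall q, prun q (ob s) = PDone -> suffix_spec q s.
Proof.
  induction s as [|b s IH]; intros q H.
  - destruct q; try discriminate. reflexivity.
  - cbn in H. change (fold_left pnext (map Some s) (pnext q (Some b)))
      with (prun (pnext q (Some b)) (ob s)) in H.
    apply IH in H. destruct q, b; cbn [pnext suffix_spec] in *; try contradiction.
    + destruct H as [D HD]. now exists D.
    + destruct H as (f & D & ->). exists (f :: D). unfold enc_db, enc_list. cbn.
      now rewrite <- app_assoc.
    + subst s. now exists [].
    + destruct H as (b & l & D & ->).
      destruct (nat_start
        (true :: true :: enc_bits b ++ [false; false] ++ enc_list enc_nat l ++ enc_db D))
        as (n & l' & D' & ->); [right; now exists b, l, D|].
      exists (n, l'), D'. unfold enc_fact. cbn [fst snd]. now rewrite <- app_assoc.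
    + destruct H as (l & D & ->). exists (0, l), D. reflexivity.
    + destruct H as (b & l & D & ->). apply nat_start. right. now exists b, l, D.
    + destruct H as (l & D & ->). apply nat_start. left. now exists l, D.
    + destruct H as (c & b & l & D & ->). now exists (c :: b), l, D.
    + destruct H as (l & D & ->). now exists [], l, D.
    + destruct H as (l & D & ->). now exists l, D.
    + destruct H as (b & l & D & ->). now exists b, l, D.
    + destruct H as (b & l & D & ->). now exists true, b, l, D.
    + destruct H as (b & l & D & ->). now exists false, b, l, D.
    + destruct H as (l & D & H). now exists l, D.
    + destruct H as (n & l & D & ->). exists (n :: l), D. unfold enc_list. cbn.
      now rewrite <- !app_assoc.
    + destruct H as (D & ->). now exists [], D.
Qed.

(* What has been read when state [q] is reached. *)
Definition open_nat (s : list bool) : Prop :=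
  exists D, s = enc_items enc_fact D ++ [false; true] \/
  exists p l, s = enc_items enc_fact D ++ [false; true] ++ enc_nat p
                  ++ enc_items enc_nat l ++ [false; true].
Definition open_args (s : list bool) : Prop :=
  exists D p l, s = enc_items enc_fact D ++ [false; true] ++ enc_nat p ++ enc_items enc_nat l.

Definition prefix_spec (q : pstate) (s : list bool) : Prop :=
  match q with
  | PDb => exists D, s = enc_items enc_fact D
  | PDb0 => exists D, s = enc_items enc_fact D ++ [false]
  | PPred => exists D, s = enc_items enc_fact D ++ [false; true]
  | PArg => open_nat s
  | PLead => exists t, open_nat t /\ s = t ++ [true]
  | PNat => exists t b, open_nat t /\ s = t ++ [true; true] ++ enc_bits b
  | PBit => exists t b, open_nat t /\ s = t ++ [true; true] ++ enc_bits b ++ [true]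
  | PEnd => exists t n, open_nat t /\ s ++ [false] = t ++ enc_nat n
  | PArgs => open_args s
  | PArgs0 => exists t, open_args t /\ s = t ++ [false]
  | PDone | PDead => True
  end.

Lemma enc_items_app {A} (f : A -> list bool) l l' :
  enc_items f (l ++ l') = enc_items f l ++ enc_items f l'.
Proof. apply flat_map_app. Qed.

Lemma enc_list_items {A} (f : A -> list bool) l : enc_list f l = enc_items f l ++ [false; false].
Proof. reflexivity. Qed.

Ltac app_eq :=
  repeat first [progress rewrite <- ?app_assoc, ?app_nil_r | progress cbn [app]]; reflexivity.

Lemma open_nat_close t n : open_nat t -> open_args (t ++ enc_nat n).
Proof.
  intros (D & [->|(p & l & ->)]).
  - exists D, n, []. cbn [enc_items flat_map]. app_eq.
  - exists D, p, (l ++ [n]). rewrite enc_items_app. cbn [enc_items flat_map]. app_eq.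
Qed.

(** Needed to see that a position in state [PPred] is preceded by complete facts, so that the fact
    read there is an item of the list and not a substring of one. *)
Lemma prefix_parse s : prefix_spec (prun PDb (ob s)) s.
Proof.
  induction s as [|b s IH] using rev_ind; [now exists []|].
  unfold ob. rewrite map_app, prun_app. cbn. fold (ob s).
  destruct (prun PDb (ob s)), b; cbn [pnext prefix_spec] in *; try exact I.
  - destruct IH as [D ->]. now exists D.
  - destruct IH as [D ->]. exists D. app_eq.
  - destruct IH as [D ->]. exists (enc_items enc_fact D ++ [false; true]).
    split; [|reflexivity]. exists D. now left.
  (* The number is 0, whose encoding is the terminator alone. *)
  - destruct IH as [D ->]. exists (enc_items enc_fact D ++ [false; true]), 0.
    split; [exists D; now left|]. app_eq.
  - now exists s.
  - exists s, 0. split; [assumption|]. app_eq.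
  - destruct IH as (t & b & Ht & ->). exists t, b. split; [assumption|].
    app_eq.
  - destruct IH as (t & b & Ht & ->). destruct (nat_bits_surj b) as [n Hn].
    exists t, n. split; [assumption|]. unfold enc_nat. rewrite Hn.
    fold (enc_bits b). cbn [flat_map]. app_eq.
  - destruct IH as (t & n & Ht & E). rewrite E. now apply open_nat_close.
  - destruct IH as (t & Ht & ->). exists t, []. split; [assumption|]. app_eq.
  - destruct IH as (t & b & Ht & ->). exists t, (b ++ [true]). split; [assumption|].
    unfold enc_bits. rewrite flat_map_app. cbn [flat_map]. app_eq.
  - destruct IH as (t & b & Ht & ->). exists t, (b ++ [false]). split; [assumption|].
    unfold enc_bits. rewrite flat_map_app. cbn [flat_map]. app_eq.
  - now exists s.
  - destruct IH as (t & (D & p & l & ->) & ->). exists D. right. exists p, l.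
    app_eq.
  - destruct IH as (t & (D & p & l & ->) & ->). exists (D ++ [(p, l)]).
    rewrite enc_items_app. cbn [enc_items flat_map]. unfold enc_fact. cbn [fst snd].
    rewrite enc_list_items. app_eq.
Qed.

Lemma prun_bits b : prun PNat (ob (enc_bits b)) = PNat.
Proof. induction b as [|c b IH]; [reflexivity|]. exact IH. Qed.

Lemma nat_bits_lead n : nat_bits n = [] \/ exists b, nat_bits n = true :: b.
Proof. unfold nat_bits. destruct (N.of_nat n); [now left|right; eauto]. Qed.

Lemma prun_enc_nat q n : q = PPred \/ q = PArg -> prun q (ob (enc_nat n)) = PArgs.
Proof.
  intros Hq. unfold enc_nat. destruct (nat_bits_lead n) as [->|[b ->]].
  - now destruct Hq as [-> | ->].
  - fold (enc_bits (true :: b)). unfold ob. rewrite map_app, prun_app.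
    fold (ob (enc_bits (true :: b))).
    replace (prun q (ob (enc_bits (true :: b)))) with PNat; [reflexivity|].
    symmetry. destruct Hq as [-> | ->]; exact (prun_bits b).
Qed.

Lemma prun_items_nat l : prun PArgs (ob (enc_items enc_nat l)) = PArgs.
Proof.
  induction l as [|n l IH]; [reflexivity|]. cbn [enc_items flat_map].
  unfold ob. rewrite !map_app, !prun_app. cbn [map].
  change (prun PArgs [Some false; Some true]) with PArg.
  change (map Some (enc_nat n)) with (ob (enc_nat n)).
  rewrite prun_enc_nat by now right. exact IH.
Qed.

Lemma prun_enc_args l : prun PArgs (ob (enc_list enc_nat l)) = PDb.
Proof.
  rewrite enc_list_items. unfold ob. rewrite map_app, prun_app.
  change (map Some (enc_items enc_nat l)) with (ob (enc_items enc_nat l)).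
  now rewrite prun_items_nat.
Qed.

Lemma prun_enc_fact f : prun PPred (ob (enc_fact f)) = PDb.
Proof.
  unfold enc_fact, ob. rewrite map_app, prun_app.
  change (map Some (enc_nat (fst f))) with (ob (enc_nat (fst f))).
  rewrite prun_enc_nat by now left. apply prun_enc_args.
Qed.

Lemma prun_items_fact D : prun PDb (ob (enc_items enc_fact D)) = PDb.
Proof.
  induction D as [|f D IH]; [reflexivity|]. cbn [enc_items flat_map].
  unfold ob. rewrite !map_app, !prun_app. cbn [map].
  change (prun PDb [Some false; Some true]) with PPred.
  change (map Some (enc_fact f)) with (ob (enc_fact f)). rewrite prun_enc_fact. exact IH.
Qed.

Lemma prun_enc_db D : prun PDb (ob (enc_db D)) = PDone.
Proof.
  unfold enc_db. rewrite enc_list_items. unfold ob. rewrite map_app, prun_app.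
  change (map Some (enc_items enc_fact D)) with (ob (enc_items enc_fact D)).
  now rewrite prun_items_fact.
Qed.

(** Since [PArgs] does not occur inside a number, the end of a number is definable as the next
    position in this state. *)
Lemma prun_inside_nat q n s t : q = PPred \/ q = PArg -> enc_nat n = s ++ t -> t <> [] ->
  prun q (ob s) <> PArgs.
Proof.
  assert (HN : forall b s t, enc_bits b ++ [false; false] = s ++ t -> t <> [] ->
    prun PNat (ob s) <> PArgs).
  { clear. induction b as [|c b IH]; intros s t E Ht.
    - destruct s as [|? [|? s]]; cbn in E.
      + discriminate.
      + injection E as <- _. discriminate.
      + injection E as _ _ E. symmetry in E. apply app_eq_nil in E. tauto.
    - destruct s as [|? [|? s]]; cbn in E.
      + discriminate.
      + injection E as <- _. discriminate.
      + injection E as <- <- E. exact (IH s t E Ht). }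
  intros Hq E Ht. unfold enc_nat in E. fold (enc_bits (nat_bits n)) in E.
  destruct (nat_bits_lead n) as [Hb|[b Hb]]; rewrite Hb in E; cbn in E.
  - destruct s as [|? [|? s]]; cbn in E.
    + destruct Hq; subst; discriminate.
    + injection E as <- _. destruct Hq; subst; discriminate.
    + injection E as _ _ E. symmetry in E. apply app_eq_nil in E. tauto.
  - destruct s as [|? [|? s]]; cbn in E.
    + destruct Hq; subst; discriminate.
    + injection E as <- _. destruct Hq; subst; discriminate.
    + injection E as <- <- E. destruct Hq; subst; exact (HN b s t E Ht).
Qed.

(** * Repairs of acyclic sets of dependencies *)

Lemma sat_lit_mono (S S' : factset) nu l :
  (forall f, S f -> S' f) -> sat_lit S nu l -> sat_lit S' nu l.
Proof. intros H. destruct l as [[|p ts]|t1 t2]; cbn; auto. Qed.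

Lemma sat_conj_mono (S S' : factset) nu g :
  (forall f, S f -> S' f) -> sat_conj S nu g -> sat_conj S' nu g.
Proof. intros H. apply Forall_impl. intros l. now apply sat_lit_mono. Qed.

Lemma sat_ucq_mono (S S' : factset) nu Q :
  (forall f, S f -> S' f) -> sat_ucq S nu Q -> sat_ucq S' nu Q.
Proof.
  intros H. apply Exists_impl. intros q (nu' & H1 & H2). exists nu'.
  split; [assumption|]. now apply (sat_conj_mono S).
Qed.

Lemma consistent_ext Sigma (S S' : factset) :
  (forall f, S f <-> S' f) -> consistent Sigma S -> consistent Sigma S'.
Proof.
  intros H. apply Forall_impl. intros d Hd nu Hb.
  apply (sat_ucq_mono S); [firstorder|]. apply Hd.
  apply (sat_conj_mono S'); [firstorder|assumption].
Qed.

Lemma exists_minimal {A} (lt : A -> A -> Prop) (P : A -> Prop) (l : list A) :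
  (forall x y z, lt x y -> lt y z -> lt x z) -> (forall x, ~ lt x x) ->
  (exists x, In x l /\ P x) ->
  exists x, In x l /\ P x /\ forall y, In y l -> P y -> ~ lt y x.
Proof.
  intros Htr Hirr. induction l as [|a l IH]; intros (x & Hx & Px); [contradiction|].
  destruct (classic (exists x, In x l /\ P x)) as [Hl|Hl].
  - destruct (IH Hl) as (m & Hm & Pm & Hmin).
    destruct (classic (P a /\ lt a m)) as [[Pa Ham]|N].
    + exists a. split; [now left|]. split; [assumption|].
      intros y [<-|Hy] Py Hya; [now apply (Hirr a)|].
      apply (Hmin y Hy Py). now apply (Htr y a m).
    + exists m. split; [now right|]. split; [assumption|].
      intros y [<-|Hy] Py Hym; [tauto|]. now apply (Hmin y).
  - exists x. split; [assumption|]. split; [assumption|]. intros y Hy Py Hyx.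
    destruct Hy as [<-|Hy]; [|apply Hl; now exists y].
    destruct Hx as [<-|Hx]; [|apply Hl; now exists x]. now apply (Hirr a).
Qed.

Lemma dep_path_in Sigma d d' : dep_path Sigma d d' -> In d Sigma /\ In d' Sigma.
Proof. induction 1; tauto. Qed.

Lemma dep_path_trans Sigma d d' d'' :
  dep_path Sigma d d' -> dep_path Sigma d' d'' -> dep_path Sigma d d''.
Proof.
  induction 1 as [a b Ha Hb E|a b c Ha E Hp IH]; intros H.
  - now apply dp_step with b.
  - apply dp_step with b; auto.
Qed.

(* A fact over [s] in the body of a dependency may require, through a chain of
   dependencies, a fact over [t]. *)
Definition requires (Sigma : list dep) (s t : option (nat * nat)) : Prop :=
  exists d d', In s (body_syms d) /\ In t (head_syms d') /\
    (In d Sigma /\ d = d' \/ dep_path Sigma d d').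

(** The shared symbol [t] lies in a head of the first chain and in a body of the second, so it
    supplies the edge that joins them; in the same way a chain from a symbol to itself closes to a
    cycle. *)
Lemma requires_trans Sigma s t u :
  requires Sigma s t -> requires Sigma t u -> requires Sigma s u.
Proof.
  intros (a & b & Ha & Hb & Hab) (c & d & Hc & Hd & Hcd). exists a, d.
  split; [assumption|]. split; [assumption|]. right.
  assert (E : dep_edge b c) by (now exists t).
  assert (Hb' : In b Sigma).
  { destruct Hab as [[H ->]|H]; [assumption|]. now apply dep_path_in in H. }
  assert (Hc' : In c Sigma).
  { destruct Hcd as [[H _]|H]; [assumption|]. now apply dep_path_in in H. }
  assert (Hbc : dep_path Sigma b c) by now apply dp_one.
  assert (Hac : dep_path Sigma a c).
  { destruct Hab as [[_ ->]|H]; [assumption|]. now apply dep_path_trans with b. }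
  destruct Hcd as [[_ <-]|H]; [assumption|]. now apply dep_path_trans with c.
Qed.

Lemma requires_irrefl Sigma s : acyclic Sigma -> ~ requires Sigma s s.
Proof.
  intros Hac (a & b & Ha & Hb & [[Hin <-]|H]).
  - apply (Hac a Hin). apply dp_one; auto. now exists s.
  - destruct (dep_path_in _ _ _ H) as [Hia Hib]. apply (Hac a Hia).
    apply dep_path_trans with b; [assumption|]. apply dp_one; auto. now exists s.
Qed.

Definition fact_sym (f : fact) : option (nat * nat) := Some (fst f, length (snd f)).
Definition add_fact (R : factset) (f : fact) : factset := fun g => R g \/ g = f.

Lemma sat_conj_relevant (S S' : factset) nu g :
  (forall f, In (fact_sym f) (syms_conj g) -> S f -> S' f) ->
  sat_conj S nu g -> sat_conj S' nu g.
Proof.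
  intros H Hg. apply Forall_forall. intros l Hl.
  pose proof (proj1 (Forall_forall _ _) Hg l Hl) as Hs.
  destruct l as [[|p ts]|t1 t2]; cbn in *; auto.
  apply H; [|assumption]. unfold syms_conj. apply in_flat_map.
  exists (LAtom (APred p ts)). split; [assumption|]. left. unfold fact_sym.
  cbn. now rewrite length_map.
Qed.

(* If [R'] is a consistent proper superset of [R], adding to [R] a fact [f] of
   [R'] as far downstream as possible keeps [R] consistent: the facts that [f]
   requires in [R'] are further downstream, so they are already in [R]. *)
Lemma one_fact_extension Sigma (D : database) (R R' : factset) :
  acyclic Sigma -> consistent Sigma R -> consistent Sigma R' ->
  (forall f, R f -> R' f) -> (forall f, R' f -> In f D) ->
  (exists f, R' f /\ ~ R f) ->
  exists f, In f D /\ ~ R f /\ consistent Sigma (add_fact R f).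
Proof.
  intros Hac HR HR' Hsub HD (f0 & Hf0 & Nf0).
  destruct (exists_minimal (fun f g => requires Sigma (fact_sym g) (fact_sym f))
              (fun f => R' f /\ ~ R f) D) as (f & Hf & [Rf Nf] & Hmin).
  - intros x y z Hxy Hyz. now apply requires_trans with (fact_sym y).
  - intros x. now apply requires_irrefl.
  - exists f0. auto.
  - exists f. split; [assumption|]. split; [assumption|].
    apply Forall_forall. intros d Hd nu Hb.
    destruct (classic (sat_conj R nu (dep_body d))) as [HbR|HbR].
    + apply (sat_ucq_mono R); [now left|].
      exact (proj1 (Forall_forall _ _) HR d Hd nu HbR).
    + assert (Hsym : In (fact_sym f) (body_syms d)).
      { apply NNPP. intros N. apply HbR.
        apply (sat_conj_relevant (add_fact R f)); [|assumption].
        intros g Hg [Hg'|Hg']; [assumption|]. subst g. contradiction. }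
      assert (Hb' : sat_conj R' nu (dep_body d)).
      { apply (sat_conj_mono (add_fact R f)); [|assumption].
        intros g [Hg| ->]; auto. }
      pose proof (proj1 (Forall_forall _ _) HR' d Hd nu Hb') as Hh.
      apply Exists_exists in Hh. destruct Hh as (q & Hq & nu' & Hnu & Hc).
      apply Exists_exists. exists q. split; [assumption|]. exists nu'. split; [assumption|].
      apply (sat_conj_relevant R'); [|assumption]. intros g Hg Rg. left.
      apply NNPP. intros Ng. apply (Hmin g); auto.
      exists d, d. split; [assumption|]. split; [|left; auto].
      unfold head_syms. apply in_flat_map. eauto.
Qed.

Lemma repair_iff Sigma (D : database) (R : factset) : acyclic Sigma ->
  is_repair Sigma D R <->
  (forall f, R f -> In f D) /\ consistent Sigma R /\
  (forall f, In f D -> ~ R f -> ~ consistent Sigma (add_fact R f)).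
Proof.
  intros Hac. split; intros (HD & HR & H); repeat split; auto.
  - intros f Hf Nf Hc. apply Nf. apply (H (add_fact R f)); auto.
    + now left.
    + intros g [Hg| ->]; auto.
    + now right.
  - intros R' Hsub HD' HR' f Hf. apply NNPP. intros Nf.
    destruct (one_fact_extension Sigma D R R') as (g & Hg & Ng & Hc); eauto.
    exact (H g Hg Ng Hc).
Qed.

(** * First-order satisfaction over positions *)

(* The certificate is cut into blocks as long as the encoded database; bit [p] of
   the block at [b] tells whether the fact encoded at position [p] is kept. *)
Definition Bit (w : word) (b p : nat) : Prop :=
  exists j, j < length w /\ Plus w b p j /\ Sym w (Some true) j.
Definition NatPos (w : word) (y : nat) : Prop := St w PPred y \/ St w PArg y.
Definition EndNat (w : word) (y z : nat) : Prop :=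
  Lt w y z /\ St w PArgs z /\
  forall i, i < length w -> ~ (Lt w y i /\ Lt w i z /\ St w PArgs i).
(** Two numbers are compared in place: they have the same distance [k] to their ends and the same
    bit at every offset below [k]. *)
Definition SameNat (w : word) (y z : nat) : Prop :=
  exists y', y' < length w /\ EndNat w y y' /\
  exists z', z' < length w /\ EndNat w z z' /\
  exists k, k < length w /\ Plus w y k y' /\ Plus w z k z' /\
  forall i, i < length w -> forall u, u < length w -> forall v, v < length w ->
    Lt w i k -> Plus w y i u -> Plus w z i v ->
    (Sym w (Some true) u /\ Sym w (Some true) v \/
     ~ Sym w (Some true) u /\ ~ Sym w (Some true) v).
Definition SamePos (w : word) (p q : nat) : Prop := Le w p q /\ Le w q p.

(* Variables are interpreted by positions at which their value is encoded. *)
Definition TermAt (w : word) (mu : nat -> nat) (t : term) (y : nat) : Prop :=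
  match t with TConst c => AtStr w (enc_nat c) y | TVar v => SameNat w (mu v) y end.

Fixpoint ArgsAt (w : word) (mu : nat -> nat) (ts : list term) (z : nat) : Prop :=
  match ts with
  | [] => AtStr w [false; false] z
  | t :: ts =>
      AtStr w [false; true] z /\
      exists y, y < length w /\ Shift w 2 z y /\ TermAt w mu t y /\
      exists z', z' < length w /\ EndNat w y z' /\ ArgsAt w mu ts z'
  end.

Definition PAtom (w : word) (S : nat -> Prop) (mu : nat -> nat) (a : atom) : Prop :=
  match a with
  | ABot => False
  | APred P ts =>
      exists p, p < length w /\ St w PPred p /\ S p /\ AtStr w (enc_nat P) p /\
      exists z, z < length w /\ Shift w (length (enc_nat P)) p z /\ ArgsAt w mu ts z
  end.

(** A constant of the dependencies or of the query need not occur in the database, so it may have no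
    position; it is compared as a fixed string. *)
Definition PNeq (w : word) (mu : nat -> nat) (t t' : term) : Prop :=
  match t, t' with
  | TVar v, TVar v' => ~ SameNat w (mu v) (mu v')
  | TVar v, TConst c | TConst c, TVar v => ~ AtStr w (enc_nat c) (mu v)
  | TConst c, TConst c' => c <> c'
  end.

Definition PLit (w : word) (S : nat -> Prop) (mu : nat -> nat) (l : lit) : Prop :=
  match l with LAtom a => PAtom w S mu a | LNeq t t' => PNeq w mu t t' end.

Definition PConj (w : word) (S : nat -> Prop) (mu : nat -> nat) (g : list lit) : Prop :=
  Forall (PLit w S mu) g.

Fixpoint ExV (w : word) (vs : list nat) (R : (nat -> nat) -> Prop) (mu : nat -> nat) : Prop :=
  match vs with
  | [] => R mu
  | v :: vs => exists p, p < length w /\ NatPos w p /\ ExV w vs R (upd mu v p)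
  end.

Definition PCq (w : word) (S : nat -> Prop) (mu : nat -> nat) (q : cq) : Prop :=
  ExV w (cq_ex q) (fun mu => PConj w S mu (cq_body q)) mu.
Definition PUcq (w : word) (S : nat -> Prop) (mu : nat -> nat) (Q : list cq) : Prop :=
  Exists (PCq w S mu) Q.
Definition PDep (w : word) (S : nat -> Prop) (mu : nat -> nat) (d : dep) : Prop :=
  ~ ExV w (vars_conj (dep_body d))
      (fun mu => PConj w S mu (dep_body d) /\ ~ PUcq w S mu (dep_head d)) mu.
Definition PCons (w : word) (S : nat -> Prop) (mu : nat -> nat) (Sigma : list dep) : Prop :=
  Forall (PDep w S mu) Sigma.

(* If the bits of two occurrences of the same fact differed, the second condition
   would fail at the occurrence with bit 0; so the bits define a set of facts. *)
Definition PRepair (Sigma : list dep) (w : word) (b : nat) : Prop :=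
  PCons w (Bit w b) (fun _ => b) Sigma /\
  forall p, p < length w -> St w PPred p -> ~ Bit w b p ->
    ~ PCons w (fun q => Bit w b q \/ SamePos w q p) (fun _ => b) Sigma.
Definition InRepairs (Sigma : list dep) (w : word) (p : nat) : Prop :=
  forall b, b < length w -> PRepair Sigma w b -> Bit w b p.
(** A string that encodes no database lies in the complement of the problem and has to be accepted;
    hence the premise that the parser has finished at a separator. *)
Definition Verifier (Sigma : list dep) (Q : list cq) (w : word) (mu : nat -> nat) : Prop :=
  (exists N, N < length w /\ Sym w None N /\ St w PDone N) ->
  ~ PUcq w (InRepairs Sigma w) mu Q.

(** * Definability of the verifier *)

Lemma FO_Bit i j : FO (fun w e => Bit w (e i) (e j)).
Proof. unfold Bit. fo. Qed.
Lemma FO_NatPos i : FO (fun w e => NatPos w (e i)).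
Proof. unfold NatPos. fo. Qed.
Lemma FO_EndNat i j : FO (fun w e => EndNat w (e i) (e j)).
Proof. unfold EndNat. fo. Qed.
#[export] Hint Resolve FO_Bit FO_NatPos FO_EndNat : fo.
Lemma FO_SameNat i j : FO (fun w e => SameNat w (e i) (e j)).
Proof. unfold SameNat. fo. Qed.
Lemma FO_SamePos i j : FO (fun w e => SamePos w (e i) (e j)).
Proof. unfold SamePos. fo. Qed.
#[export] Hint Resolve FO_SameNat FO_SamePos : fo.

Lemma FO_TermAt (ix : nat -> nat) t i : FO (fun w e => TermAt w (fun v => e (ix v)) t (e i)).
Proof. destruct t; cbn [TermAt]; fo. Qed.

Lemma FO_ArgsAt ts : forall (ix : nat -> nat) i,
  FO (fun w e => ArgsAt w (fun v => e (ix v)) ts (e i)).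
Proof.
  induction ts as [|t ts IH]; intros ix i; cbn [ArgsAt]; fo.
  apply (FO_TermAt (fun v => S (ix v))).
Qed.

(* [S w pi] is a set of positions with parameters [pi]; the renaming [jx] makes the
   notion stable under the shift of indices below a quantifier. *)
Definition FOset (S : word -> (nat -> nat) -> nat -> Prop) : Prop :=
  forall (jx : nat -> nat) i, FO (fun w e => S w (fun k => e (jx k)) (e i)).

Section Definability.
Context {T : word -> (nat -> nat) -> nat -> Prop} (HT : FOset T).

Lemma FO_PLit l (jx ix : nat -> nat) :
  FO (fun w e => PLit w (T w (fun k => e (jx k))) (fun v => e (ix v)) l).
Proof.
  destruct l as [[|P ts]|[c|v] [c'|v']]; cbn [PLit PAtom PNeq]; fo.
  apply (FO_ArgsAt ts (fun v => S (S (ix v)))).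
Qed.

Lemma FO_PConj g (jx ix : nat -> nat) :
  FO (fun w e => PConj w (T w (fun k => e (jx k))) (fun v => e (ix v)) g).
Proof.
  apply (FO_Forall (fun l w e => PLit w (T w (fun k => e (jx k))) (fun v => e (ix v)) l)).
  intros l _. apply FO_PLit.
Qed.
End Definability.

(** A valuation is presented by an index map [ix] into the environment. Binding [v] sends [v] to
    index 0 and shifts the other indices, so an updated valuation is again given by an index map. *)
Lemma FO_ExV (R : word -> (nat -> nat) -> (nat -> nat) -> Prop) vs :
  (forall jx ix : nat -> nat, FO (fun w e => R w (fun k => e (jx k)) (fun v => e (ix v)))) ->
  forall jx ix : nat -> nat,
  FO (fun w e => ExV w vs (R w (fun k => e (jx k))) (fun v => e (ix v))).
Proof.
  intros HR. induction vs as [|v vs IH]; intros jx ix; cbn [ExV]; [apply HR|].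
  apply FO_ex. apply FO_and; [apply FO_NatPos|].
  apply (FO_ext (fun w e => ExV w vs (R w (fun k => e (S (jx k))))
                    (fun u => e (if u =? v then 0 else S (ix u))))).
  - intros w e. replace (upd (fun u => e (S (ix u))) v (e 0))
      with (fun u => e (if u =? v then 0 else S (ix u))); [reflexivity|].
    apply functional_extensionality. intros u. unfold upd. now destruct (u =? v).
  - apply (IH (fun k => S (jx k)) (fun u => if u =? v then 0 else S (ix u))).
Qed.

Section Definability_of_queries.
Context {T : word -> (nat -> nat) -> nat -> Prop} (HT : FOset T).

Lemma FO_PUcq Q (jx ix : nat -> nat) :
  FO (fun w e => PUcq w (T w (fun k => e (jx k))) (fun v => e (ix v)) Q).
Proof.
  apply (FO_Exists (fun q w e => PCq w (T w (fun k => e (jx k))) (fun v => e (ix v)) q)).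
  intros q _. unfold PCq.
  apply (FO_ExV (fun w pi mu => PConj w (T w pi) mu (cq_body q))).
  intros jx' ix'. now apply FO_PConj.
Qed.

Lemma FO_PCons Sigma (jx ix : nat -> nat) :
  FO (fun w e => PCons w (T w (fun k => e (jx k))) (fun v => e (ix v)) Sigma).
Proof.
  apply (FO_Forall (fun d w e => PDep w (T w (fun k => e (jx k))) (fun v => e (ix v)) d)).
  intros d _. apply FO_not.
  apply (FO_ExV (fun w pi mu =>
    PConj w (T w pi) mu (dep_body d) /\ ~ PUcq w (T w pi) mu (dep_head d))).
  intros jx' ix'. apply FO_and; [now apply FO_PConj|]. apply FO_not. apply FO_PUcq.
Qed.
End Definability_of_queries.

Lemma FO_PRepair Sigma i : FO (fun w e => PRepair Sigma w (e i)).
Proof.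
  unfold PRepair. apply FO_and.
  - apply (@FO_PCons (fun w pi p => Bit w (pi 0) p) ltac:(intros jx j; fo)
      Sigma (fun _ => i) (fun _ => i)).
  - apply FO_all. fo.
    (* Parameter 0 is the offset of the mask and parameter 1 the added position; below the
       quantifier over that position they are the variables [S i] and 0. *)
    apply (@FO_PCons (fun w pi q => Bit w (pi 0) q \/ SamePos w q (pi 1))
      ltac:(intros jx j; fo) Sigma (fun k => match k with 0 => S i | _ => 0 end) (fun _ => S i)).
Qed.

Lemma FO_Verifier Sigma Q : FO (fun w e => Verifier Sigma Q w e).
Proof.
  unfold Verifier. fo.
  refine (@FO_PUcq (fun w _ p => InRepairs Sigma w p) _ Q (fun k => k) (fun v => v)).
  intros jx i. unfold InRepairs. fo. apply FO_PRepair.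
Qed.

(** * Passing between values and positions of variables *)

Lemma finite_choice (R : nat -> nat -> Prop) vs :
  (forall v, In v vs -> exists a, R v a) -> exists nu, forall v, In v vs -> R v (nu v).
Proof.
  induction vs as [|v vs IH]; intros H; [now exists (fun _ => 0)|].
  destruct IH as [nu Hnu]; [intros u Hu; apply H; now right|].
  destruct (H v (or_introl eq_refl)) as [a Ha]. exists (upd nu v a). intros u Hu.
  unfold upd. destruct (Nat.eqb_spec u v) as [->|N]; [assumption|].
  apply Hnu. destruct Hu; [congruence|assumption].
Qed.

(** Induction on the finite list of variables replaces an axiom of choice; off [vs] the values of
    [nu0] are kept, as the semantics of quantifiers demands. *)
Lemma finite_choice_on (R : nat -> nat -> Prop) vs nu0 :
  (forall v, In v vs -> exists a, R v a) ->
  exists nu, (forall v, In v vs -> R v (nu v)) /\ (forall v, ~ In v vs -> nu v = nu0 v).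
Proof.
  intros H. destruct (finite_choice R vs H) as [nu Hnu].
  exists (fun v => if in_dec Nat.eq_dec v vs then nu v else nu0 v). split; intros v Hv.
  - destruct (in_dec Nat.eq_dec v vs); [auto|contradiction].
  - destruct (in_dec Nat.eq_dec v vs); [contradiction|auto].
Qed.

Lemma ExV_iff w vs (R : (nat -> nat) -> Prop) mu :
  ExV w vs R mu <-> exists mu', (forall v, ~ In v vs -> mu' v = mu v) /\
    (forall v, In v vs -> NatPos w (mu' v)) /\ R mu'.
Proof.
  revert mu. induction vs as [|v vs IH]; intros mu; cbn [ExV].
  - split.
    + intros H. exists mu. cbn. tauto.
    + intros (mu' & H1 & _ & H). replace mu with mu'; [assumption|].
      apply functional_extensionality. auto.
  - split.
    + intros (p & Hp & Hn & H). apply IH in H. destruct H as (mu' & H1 & H2 & H).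
      exists mu'. split; [|split; [|assumption]].
      * intros u Hu. cbn in Hu. rewrite H1 by tauto. unfold upd.
        destruct (Nat.eqb_spec u v); [|reflexivity]. subst. tauto.
      (* The list may repeat a variable; then the innermost binding determines its value. *)
      * intros u Hu. destruct (in_dec Nat.eq_dec u vs) as [Hi|Hi]; [auto|].
        destruct Hu as [<-|Hu]; [|contradiction]. rewrite H1 by assumption.
        unfold upd. now rewrite Nat.eqb_refl.
    + intros (mu' & H1 & H2 & H). exists (mu' v). split; [|split].
      * destruct (H2 v (or_introl eq_refl)) as [[? _]|[? _]]; assumption.
      * apply H2. now left.
      * apply IH. exists mu'. split; [|split; [|assumption]].
        -- intros u Hu. unfold upd. destruct (Nat.eqb_spec u v) as [->|N]; [reflexivity|].
           apply H1. intros [E|E]; congruence.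
        -- intros u Hu. apply H2. now right.
Qed.

(** * Correctness of the verifier *)

Section GoodWord.
Variables (D : database) (c : list bool).
Let x := enc_db D.
Let w : word := ob x ++ None :: ob c.

Lemma length_ob s : length (ob s) = length s.
Proof. apply length_map. Qed.

Lemma firstn_ob k s : firstn k (ob s) = ob (firstn k s).
Proof. apply firstn_map. Qed.

Lemma word_length : length w = length x + S (length c).
Proof. unfold w. rewrite length_app. cbn. now rewrite !length_ob. Qed.

(** Every state moves to [PDead] on the separator, so no position of the certificate can be mistaken
    for the start of a fact or a number. *)
Lemma St_inside q p : St w q p -> q <> PDead ->
  p <= length x /\ prun PDb (ob (firstn p x)) = q.
Proof.
  intros [Hp E] Hq. unfold w in E. rewrite firstn_app, firstn_ob, length_ob in E.
  destruct (le_lt_dec p (length x)) as [L|L].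
  - split; [assumption|]. replace (p - length x) with 0 in E by lia.
    cbn in E. now rewrite app_nil_r in E.
  - exfalso. apply Hq. rewrite prun_app in E.
    replace (p - length x) with (S (p - length x - 1)) in E by lia.
    cbn [firstn] in E. rewrite <- E. unfold prun at 1. cbn [fold_left].
    replace (pnext (prun PDb (ob (firstn p x))) None) with PDead
      by (now destruct (prun PDb (ob (firstn p x)))).
    apply prun_dead.
Qed.

Lemma St_suffix q p : St w q p -> q <> PDead -> suffix_spec q (skipn p x).
Proof.
  intros H Hq. destruct (St_inside q p H Hq) as [_ E]. apply suffix_parse.
  rewrite <- E, <- prun_app. unfold ob. rewrite <- map_app, firstn_skipn.
  apply prun_enc_db.
Qed.

Lemma At_intro p s t : p <= length x -> skipn p x = s ++ t -> At w p s.
Proof.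
  intros Hp E. exists (ob t ++ None :: ob c). split.
  - unfold w. rewrite skipn_app, length_ob. replace (p - length x) with 0 by lia.
    unfold ob at 1. rewrite skipn_map, E, map_app, <- app_assoc. reflexivity.
  - intros N. apply app_eq_nil in N. destruct N. discriminate.
Qed.

Lemma St_step q p s : St w q p -> At w p s -> St w (prun q (ob s)) (length s + p).
Proof.
  intros [Hp E] (r & Es & Hr). split.
  - apply (f_equal (@length _)) in Es. rewrite length_skipn, length_app, length_map in Es.
    destruct r; [congruence|]. cbn in Es. lia.
  - rewrite <- E, <- prun_app. f_equal. rewrite <- (firstn_skipn p w) at 1.
    rewrite Es, firstn_app, length_firstn, Nat.min_l by lia.
    rewrite firstn_all2 by (rewrite length_firstn; lia). f_equal.
    replace (length s + p - p) with (length s) by lia.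
    rewrite firstn_app, length_map, Nat.sub_diag, firstn_O, app_nil_r.
    apply firstn_all2. rewrite ?length_ob, ?length_map. lia.
Qed.

Lemma At_lt p s : At w p s -> length s + p < length w.
Proof.
  intros H. rewrite <- (app_nil_r s) in H. apply At_app in H. now apply At_nil.
Qed.

(** What is parsed before and after [p] forms a database with the same encoding as [D], which is [D]
    itself by injectivity of [enc_db]. *)
Lemma fact_of_position p : St w PPred p -> exists f, In f D /\ At w p (enc_fact f).
Proof.
  intros H. destruct (St_inside _ _ H ltac:(discriminate)) as [Hp E].
  destruct (St_suffix _ _ H ltac:(discriminate)) as (f & D2 & Hs).
  pose proof (prefix_parse (firstn p x)) as Hpre. rewrite E in Hpre.
  destruct Hpre as [D1 HD1]. exists f. split.
  - replace D with (D1 ++ f :: D2); [apply in_elt|]. apply enc_db_inj.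
    fold x. rewrite <- (firstn_skipn p x), Hs, HD1. unfold enc_db.
    rewrite !enc_list_items, enc_items_app. cbn [enc_items flat_map]. app_eq.
  - now apply At_intro with (enc_db D2).
Qed.

Lemma position_of_fact f : In f D -> exists p, St w PPred p /\ At w p (enc_fact f).
Proof.
  intros Hf. apply in_split in Hf. destruct Hf as (D1 & D2 & HD).
  set (l := enc_items enc_fact D1 ++ [false; true]).
  assert (E : x = l ++ enc_fact f ++ enc_db D2).
  { unfold x, l, enc_db. rewrite HD, !enc_list_items, enc_items_app.
    cbn [enc_items flat_map]. app_eq. }
  assert (E' : skipn (length l) x = enc_fact f ++ enc_db D2)
    by (rewrite E, skipn_app, skipn_all, Nat.sub_diag; reflexivity).
  assert (Hl : length l <= length x) by (rewrite E, length_app; lia).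
  exists (length l). split.
  - split; [rewrite word_length; lia|]. unfold w.
    rewrite firstn_app, firstn_ob, length_ob. replace (length l - length x) with 0 by lia.
    cbn [firstn]. rewrite app_nil_r, E, firstn_app, firstn_all, Nat.sub_diag, firstn_O, app_nil_r.
    unfold l, ob. rewrite map_app, prun_app. fold (ob (enc_items enc_fact D1)).
    now rewrite prun_items_fact.
  - now apply At_intro with (enc_db D2).
Qed.

Definition NatAt (y a : nat) : Prop := NatPos w y /\ At w y (enc_nat a).

Lemma nat_of_position y : NatPos w y -> exists a, NatAt y a.
Proof.
  intros H. destruct H as [H|H].
  - destruct (St_inside _ _ H ltac:(discriminate)) as [Hy _].
    destruct (St_suffix _ _ H ltac:(discriminate)) as (f & D2 & Hs).
    exists (fst f). split; [now left|].
    apply At_intro with (enc_list enc_nat (snd f) ++ enc_db D2); [assumption|].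
    rewrite Hs. unfold enc_fact. app_eq.
  - destruct (St_inside _ _ H ltac:(discriminate)) as [Hy _].
    destruct (St_suffix _ _ H ltac:(discriminate)) as (a & l & D2 & Hs).
    exists a. split; [now right|]. now apply At_intro with (enc_list enc_nat l ++ enc_db D2).
Qed.

Lemma NatAt_St y a : NatAt y a -> exists q, (q = PPred \/ q = PArg) /\ St w q y.
Proof. intros [[H|H] _]; eauto. Qed.

Lemma NatAt_end y a : NatAt y a -> St w PArgs (length (enc_nat a) + y).
Proof.
  intros H. destruct (NatAt_St y a H) as (q & Hq & Hs).
  rewrite <- (prun_enc_nat q a Hq). apply St_step; [assumption|]. apply H.
Qed.

Lemma NatAt_inside y a i : NatAt y a -> i < length (enc_nat a) -> ~ St w PArgs (i + y).
Proof.
  intros H Hi [_ N]. destruct (NatAt_St y a H) as (q & Hq & Hs).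
  destruct H as [_ H]. rewrite <- (firstn_skipn i (enc_nat a)) in H.
  apply At_app in H. destruct H as [H _].
  apply (St_step q y) in H; [|assumption].
  rewrite length_firstn, Nat.min_l in H by lia. destruct H as [_ H]. rewrite N in H.
  apply (prun_inside_nat q a (firstn i (enc_nat a)) (skipn i (enc_nat a)) Hq); auto.
  - now rewrite firstn_skipn.
  - apply skipn_nonempty. lia.
Qed.

Lemma enc_nat_nonempty a : 0 < length (enc_nat a).
Proof. unfold enc_nat. rewrite length_app. cbn. lia. Qed.

Lemma EndNat_iff y a z : NatAt y a -> EndNat w y z <-> z = length (enc_nat a) + y.
Proof.
  intros H. pose proof (NatAt_end y a H) as He. pose proof (enc_nat_nonempty a) as Hn.
  assert (L : length (enc_nat a) + y < length w) by apply He.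
  unfold EndNat. split.
  - intros (H1 & H2 & H3). apply Lt_iff in H1.
    destruct (lt_eq_lt_dec z (length (enc_nat a) + y)) as [[Lz|Ez]|Lz]; [|assumption|].
    + exfalso. apply (NatAt_inside y a (z - y) H); [lia|].
      now replace (z - y + y) with z by lia.
    + exfalso. apply (H3 (length (enc_nat a) + y)); [assumption|].
      rewrite !Lt_iff. repeat split; try lia. apply He.
  - intros ->. rewrite Lt_iff. split; [lia|]. split; [assumption|].
    intros i Hi (H1 & H2 & H3). apply Lt_iff in H1. apply Lt_iff in H2.
    apply (NatAt_inside y a (i - y) H); [lia|]. now replace (i - y + y) with i by lia.
Qed.

Lemma AtStr_nat_iff y a k : NatAt y a -> AtStr w (enc_nat k) y <-> k = a.
Proof.
  intros [_ H]. rewrite AtStr_iff. split.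
  - intros H'. now apply (prefix_free_At enc_nat w y k a enc_nat_prefix_free).
  - now intros ->.
Qed.

Lemma At_nth y s i : At w y s -> i < length s ->
  nth_error w (y + i) = Some (Some (nth i s false)).
Proof.
  intros H Hi. rewrite <- (firstn_skipn i s) in H. apply At_app in H. destruct H as [_ H].
  rewrite length_firstn, Nat.min_l in H by lia.
  destruct (skipn i s) as [|b t] eqn:E.
  - exfalso. apply (f_equal (@length _)) in E. rewrite length_skipn in E. cbn in E. lia.
  - change (b :: t) with ([b] ++ t) in H. apply At_app in H. destruct H as [H _].
    apply At_sym in H. destruct H as [H _]. rewrite Nat.add_comm, H. do 2 f_equal.
    rewrite <- (firstn_skipn i s), E, app_nth2 by (rewrite length_firstn; lia).
    now rewrite length_firstn, Nat.min_l, Nat.sub_diag by lia.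
Qed.

Lemma SameNat_iff y z a b : NatAt y a -> NatAt z b -> SameNat w y z <-> a = b.
Proof.
  intros Hy Hz. unfold SameNat.
  pose proof (At_lt _ _ (proj2 Hy)) as Ly. pose proof (At_lt _ _ (proj2 Hz)) as Lz. split.
  - intros (y' & _ & E1 & z' & _ & E2 & k & _ & P1 & P2 & Hsame).
    apply (EndNat_iff y a) in E1; [|assumption]. apply (EndNat_iff z b) in E2; [|assumption].
    destruct P1 as [P1 _], P2 as [P2 _]. subst y' z'.
    assert (E : enc_nat a = enc_nat b).
    { apply (nth_ext _ _ false false); [lia|]. intros i Hi.
      destruct (Hsame i ltac:(lia) (y + i) ltac:(lia) (z + i) ltac:(lia)) as [[H1 H2]|[H1 H2]].
      - apply Lt_iff. lia.
      - split; lia.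
      - split; lia.
      - unfold Sym in *. rewrite (At_nth y (enc_nat a) i (proj2 Hy)) in H1 by lia.
        rewrite (At_nth z (enc_nat b) i (proj2 Hz)) in H2 by lia. congruence.
      - unfold Sym in *. rewrite (At_nth y (enc_nat a) i (proj2 Hy)) in H1 by lia.
        rewrite (At_nth z (enc_nat b) i (proj2 Hz)) in H2 by lia.
        destruct (nth i (enc_nat a) false), (nth i (enc_nat b) false); congruence. }
    apply (enc_nat_prefix_free a b [] []). now rewrite E.
  - intros <-. exists (length (enc_nat a) + y). split; [assumption|].
    split; [now apply (EndNat_iff y a)|].
    exists (length (enc_nat a) + z). split; [assumption|].
    split; [now apply (EndNat_iff z a)|].
    exists (length (enc_nat a)). split; [lia|]. unfold Plus.
    split; [lia|]. split; [lia|]. intros i _ u _ v _ Hi [Hu _] [Hv _]. apply Lt_iff in Hi.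
    subst u v. unfold Sym. rewrite (At_nth y _ i (proj2 Hy)), (At_nth z _ i (proj2 Hz)) by lia.
    destruct (nth i (enc_nat a) false); [left; now split|right; now split].
Qed.

Definition interprets (mu nu : nat -> nat) (vs : list nat) : Prop :=
  forall v, In v vs -> NatAt (mu v) (nu v).

Lemma TermAt_iff mu nu t y a : interprets mu nu (vars_term t) -> NatAt y a ->
  TermAt w mu t y <-> eval nu t = a.
Proof.
  intros Hi Hy. destruct t as [k|v]; cbn.
  - now apply AtStr_nat_iff.
  - apply SameNat_iff; [|assumption]. apply Hi. now left.
Qed.

Lemma At_conflict z s t b b' : At w z (false :: b :: s) -> At w z (false :: b' :: t) -> b = b'.
Proof. intros (r & E & _) (r' & E' & _). rewrite E in E'. cbn in E'. congruence. Qed.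

Lemma first_arg z a l : St w PArgs z -> At w z (enc_list enc_nat (a :: l)) ->
  NatAt (2 + z) a /\ At w (length (enc_nat a) + (2 + z)) (enc_list enc_nat l).
Proof.
  intros Hz H.
  replace (enc_list enc_nat (a :: l)) with ([false; true] ++ enc_nat a ++ enc_list enc_nat l) in H
    by (rewrite !enc_list_items; cbn [enc_items flat_map]; app_eq).
  apply At_app in H. destruct H as [H1 H]. apply At_app in H. destruct H as [H2 H3].
  split; [|exact H3]. split; [|exact H2]. right.
  exact (St_step PArgs z [false; true] Hz H1).
Qed.

Lemma ArgsAt_iff mu nu ts : forall z l, interprets mu nu (flat_map vars_term ts) ->
  St w PArgs z -> At w z (enc_list enc_nat l) ->
  ArgsAt w mu ts z <-> map (eval nu) ts = l.
Proof.
  induction ts as [|t ts IH]; intros z l Hi Hz Ha; cbn [ArgsAt map].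
  - rewrite AtStr_iff. destruct l as [|a l].
    + now split.
    + split; [|discriminate]. intros H. exfalso.
      pose proof (At_conflict z _ _ _ _ H Ha). discriminate.
  - rewrite AtStr_iff. destruct l as [|a l].
    + split; [|discriminate]. intros [H _]. exfalso.
      pose proof (At_conflict z _ _ _ _ H Ha). discriminate.
    + destruct (first_arg z a l Hz Ha) as [Hy Hl].
      pose proof (At_lt _ _ (proj2 Hy)) as Ly.
      assert (Hit : interprets mu nu (vars_term t)) by (intros v Hv; apply Hi, in_app_iff; now left).
      assert (His : interprets mu nu (flat_map vars_term ts))
        by (intros v Hv; apply Hi, in_app_iff; now right).
      pose proof (TermAt_iff mu nu t (2 + z) a Hit Hy) as Ht.
      pose proof (IH _ l His (NatAt_end _ _ Hy) Hl) as Hr.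
      split.
      * intros (_ & y & _ & Hs & H1 & z' & _ & He & H2). apply Shift_iff in Hs.
        destruct Hs as [-> _]. apply (EndNat_iff _ a) in He; [|assumption]. subst z'.
        apply Ht in H1. apply Hr in H2. congruence.
      * intros E. injection E as E1 E2. split.
        -- change (false :: true :: enc_nat a ++ enc_list enc_nat l)
             with ([false; true] ++ enc_nat a ++ enc_list enc_nat l) in Ha.
           replace (enc_list enc_nat (a :: l)) with ([false; true] ++ enc_nat a ++ enc_list enc_nat l) in Ha
             by (rewrite !enc_list_items; cbn [enc_items flat_map]; app_eq).
           now apply At_app in Ha.
        -- exists (2 + z). split; [lia|]. split; [apply Shift_iff; lia|].
           split; [now apply Ht|]. exists (length (enc_nat a) + (2 + z)). split; [assumption|].
           split; [now apply (EndNat_iff _ a)|]. now apply Hr.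
Qed.

(** The list [D] may repeat a fact; one selected occurrence suffices. *)
Definition facts_at (S : nat -> Prop) : factset :=
  fun f => exists p, S p /\ St w PPred p /\ At w p (enc_fact f).

Lemma PAtom_iff S mu nu a : interprets mu nu (vars_atom a) ->
  PAtom w S mu a <-> sat_atom (facts_at S) nu a.
Proof.
  destruct a as [|P ts]; intros Hi; cbn; [tauto|]. split.
  - intros (p & _ & Hst & HS & HP & z & _ & Hz & Ha). exists p.
    split; [assumption|]. split; [assumption|].
    destruct (fact_of_position p Hst) as ([P0 l] & _ & Hf).
    unfold enc_fact in Hf. cbn [fst snd] in Hf. apply At_app in Hf. destruct Hf as [H1 H2].
    apply AtStr_iff in HP. pose proof (prefix_free_At enc_nat w p P P0 enc_nat_prefix_free HP H1).
    subst P0. apply Shift_iff in Hz. destruct Hz as [-> _].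
    apply (ArgsAt_iff mu nu ts _ l Hi) in Ha.
    + unfold enc_fact. cbn [fst snd]. apply At_app. now rewrite Ha.
    + apply (NatAt_end p P). split; [now left|assumption].
    + assumption.
  - intros (p & HS & Hst & Hf). unfold enc_fact in Hf. cbn [fst snd] in Hf.
    apply At_app in Hf. destruct Hf as [H1 H2]. pose proof (At_lt _ _ H1) as L.
    exists p. split; [lia|]. split; [assumption|]. split; [assumption|].
    split; [now apply AtStr_iff|]. exists (length (enc_nat P) + p). split; [assumption|].
    split; [apply Shift_iff; lia|].
    apply (ArgsAt_iff mu nu ts _ (map (eval nu) ts) Hi); auto.
    apply (NatAt_end p P). split; [now left|assumption].
Qed.

Lemma PLit_iff S mu nu l : interprets mu nu (vars_lit l) ->
  PLit w S mu l <-> sat_lit (facts_at S) nu l.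
Proof.
  destruct l as [a|t t']; [apply PAtom_iff|]. intros Hi.
  destruct t as [k|v], t' as [k'|v']; cbn.
  - tauto.
  - rewrite (AtStr_nat_iff _ (nu v')) by (apply Hi; now left). tauto.
  - rewrite (AtStr_nat_iff _ (nu v)) by (apply Hi; now left).
    split; intros H E; now apply H.
  - rewrite (SameNat_iff _ _ (nu v) (nu v')).
    + tauto.
    + apply Hi. now left.
    + apply Hi. right. now left.
Qed.

Lemma PConj_iff S mu nu g : interprets mu nu (vars_conj g) ->
  PConj w S mu g <-> sat_conj (facts_at S) nu g.
Proof.
  induction g as [|l g IH]; intros Hi; unfold PConj, sat_conj.
  - split; constructor.
  - rewrite !Forall_cons_iff, PLit_iff, IH; [reflexivity| |].
    + intros v Hv. apply Hi. apply in_app_iff. now right.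
    + intros v Hv. apply Hi. apply in_app_iff. now left.
Qed.

Lemma arg_position z l a : St w PArgs z -> At w z (enc_list enc_nat l) -> In a l ->
  exists y, NatAt y a.
Proof.
  revert z. induction l as [|b l IH]; intros z Hz H Ha; [contradiction|].
  destruct (first_arg z b l Hz H) as [Hy Hl]. destruct Ha as [<-|Ha]; [eauto|].
  now apply (IH (length (enc_nat b) + (2 + z))); [apply NatAt_end| |].
Qed.

(* This is why valuations may be replaced by assignments of positions. *)
Lemma value_position S nu g v : sat_conj (facts_at S) nu g -> In v (atom_vars_conj g) ->
  exists y, NatAt y (nu v).
Proof.
  intros Hg Hv. apply in_flat_map in Hv. destruct Hv as ([a|] & Hl & Hv); [|contradiction].
  pose proof (proj1 (Forall_forall _ _) Hg _ Hl) as Hs. destruct a as [|P ts]; [contradiction|].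
  destruct Hs as (p & _ & Hst & Hf). unfold enc_fact in Hf. cbn [fst snd] in Hf.
  apply At_app in Hf. destruct Hf as [H1 H2].
  apply (arg_position (length (enc_nat P) + p) (map (eval nu) ts)); [|assumption|].
  - apply NatAt_end. split; [now left|assumption].
  - cbn in Hv. apply in_flat_map in Hv. destruct Hv as ([k|u] & Ht & Hv); [contradiction|].
    destruct Hv as [->|[]]. now apply (in_map (eval nu)) in Ht.
Qed.

(** From left to right, each chosen position holds some number. Conversely, only a value that occurs
    in a fact has a position, hence the condition that quantified variables occur in atoms. *)
Lemma PCq_iff S mu nu q :
  (forall v, In v (cq_ex q) -> In v (atom_vars_conj (cq_body q))) ->
  (forall v, In v (vars_conj (cq_body q)) -> ~ In v (cq_ex q) -> NatAt (mu v) (nu v)) ->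
  PCq w S mu q <-> sat_cq (facts_at S) nu q.
Proof.
  intros Hex Hi. unfold PCq. rewrite ExV_iff. split.
  - intros (mu' & H1 & H2 & H).
    destruct (finite_choice_on (fun v a => NatAt (mu' v) a) (cq_ex q) nu) as (nu' & Hn & Hn').
    { intros v Hv. apply nat_of_position. auto. }
    exists nu'. split; [assumption|]. apply (PConj_iff S mu' nu'); [|assumption].
    intros v Hv. destruct (in_dec Nat.eq_dec v (cq_ex q)) as [He|He]; [auto|].
    rewrite (H1 v He), (Hn' v He). auto.
  - intros (nu' & H1 & H).
    destruct (finite_choice_on (fun v y => NatAt y (nu' v)) (cq_ex q) mu) as (mu' & Hm & Hm').
    { intros v Hv. apply (value_position S nu' (cq_body q)); auto. }
    exists mu'. split; [assumption|]. split; [intros v Hv; now apply Hm|].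
    apply (PConj_iff S mu' nu'); [|assumption].
    intros v Hv. destruct (in_dec Nat.eq_dec v (cq_ex q)) as [He|He]; [auto|].
    rewrite (H1 v He), (Hm' v He). auto.
Qed.

Lemma PUcq_iff S mu nu Q :
  (forall q, In q Q ->
    (forall v, In v (cq_ex q) -> In v (atom_vars_conj (cq_body q))) /\
    (forall v, In v (vars_conj (cq_body q)) -> ~ In v (cq_ex q) -> NatAt (mu v) (nu v))) ->
  PUcq w S mu Q <-> sat_ucq (facts_at S) nu Q.
Proof.
  intros H. unfold PUcq, sat_ucq. rewrite !Exists_exists. split.
  - intros (q & Hq & Hs). exists q. split; [assumption|]. destruct (H q Hq).
    now apply (PCq_iff S mu nu q).
  - intros (q & Hq & Hs). exists q. split; [assumption|]. destruct (H q Hq).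
    now apply (PCq_iff S mu nu q).
Qed.

Lemma PDep_iff S mu d : dep_wf d -> PDep w S mu d <-> sat_dep (facts_at S) d.
Proof.
  intros (_ & Hb & _ & Hh). unfold PDep. rewrite ExV_iff.
  assert (HU : forall mu nu, interprets mu nu (vars_conj (dep_body d)) ->
    PUcq w S mu (dep_head d) <-> sat_ucq (facts_at S) nu (dep_head d)).
  { intros mu' nu Hi. apply PUcq_iff. intros q Hq. destruct (Hh q Hq) as (_ & He & Hf).
    split; auto. }
  split.
  - intros N nu Hs.
    destruct (finite_choice_on (fun v y => NatAt y (nu v)) (vars_conj (dep_body d)) mu)
      as (mu' & Hm & Hm').
    { intros v Hv. apply (value_position S nu (dep_body d)); auto. }
    apply (HU mu' nu Hm). apply NNPP. intros NU. apply N. exists mu'.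
    split; [assumption|]. split; [intros v Hv; now apply Hm|].
    split; [now apply (PConj_iff S mu' nu)|assumption].
  - intros Hd (mu' & _ & Hp & Hc & NU).
    destruct (finite_choice (fun v a => NatAt (mu' v) a) (vars_conj (dep_body d))) as (nu & Hn).
    { intros v Hv. apply nat_of_position. auto. }
    apply NU, (HU mu' nu Hn), Hd. now apply (PConj_iff S mu' nu).
Qed.

Lemma PCons_iff S mu Sigma : (forall d, In d Sigma -> dep_wf d) ->
  PCons w S mu Sigma <-> consistent Sigma (facts_at S).
Proof.
  intros H. unfold PCons, consistent. rewrite !Forall_forall.
  split; intros Hd d Hin; apply (PDep_iff S mu d (H d Hin)); auto.
Qed.

Lemma same_position_fact p f g : At w p (enc_fact f) -> At w p (enc_fact g) -> f = g.
Proof. apply prefix_free_At, enc_fact_prefix_free. Qed.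

Lemma facts_at_add b p f : St w PPred p -> At w p (enc_fact f) ->
  forall g, facts_at (fun q => Bit w b q \/ SamePos w q p) g <-> add_fact (facts_at (Bit w b)) f g.
Proof.
  intros Hp Hf g. split.
  - intros (q & [Hq|Hq] & Hst & Hg).
    + left. now exists q.
    + right. unfold SamePos in Hq. rewrite !Le_iff in Hq.
      assert (q = p) by lia. subst q. now apply (same_position_fact p).
  - intros [(q & Hq & Hst & Hg)| ->].
    + exists q. auto.
    + exists p. split; [|auto]. right. unfold SamePos. rewrite !Le_iff.
      destruct Hp. lia.
Qed.

(** * Masks that describe repairs, and correctness of the sentence *)

Section Repairs.
Variables (Sigma : list dep) (Sigma_wf : forall d, In d Sigma -> dep_wf d)
  (Sigma_acyclic : acyclic Sigma).

Lemma PRepair_sound b : PRepair Sigma w b ->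
  is_repair Sigma D (facts_at (Bit w b)) /\
  forall p f, St w PPred p -> At w p (enc_fact f) -> facts_at (Bit w b) f -> Bit w b p.
Proof.
  intros [H1 H2]. apply PCons_iff in H1; [|assumption].
  assert (Hmax : forall p f, St w PPred p -> At w p (enc_fact f) -> ~ Bit w b p ->
    ~ consistent Sigma (add_fact (facts_at (Bit w b)) f)).
  { intros p f Hp Hf Nb Hc. apply (H2 p (proj1 Hp) Hp Nb). apply PCons_iff; [assumption|].
    apply (consistent_ext Sigma (add_fact (facts_at (Bit w b)) f)); [|assumption].
    intros g. symmetry. now apply facts_at_add. }
  split.
  - apply repair_iff; [assumption|]. split; [|split; [assumption|]].
    + intros f (p & _ & Hp & Hf). destruct (fact_of_position p Hp) as (g & Hg & Hg').
      now rewrite (same_position_fact p f g Hf Hg').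
    + intros f Hf Nf. destruct (position_of_fact f Hf) as (p & Hp & Hpf).
      apply (Hmax p f Hp Hpf). intros Hb. apply Nf. now exists p.
  - intros p f Hp Hf Hin. apply NNPP. intros Nb. apply (Hmax p f Hp Hf Nb).
    apply (consistent_ext Sigma (facts_at (Bit w b))); [|assumption].
    intros g. unfold add_fact. split; [tauto|]. intros [Hg| ->]; assumption.
Qed.

Lemma PRepair_complete b R : is_repair Sigma D R ->
  (forall p f, St w PPred p -> At w p (enc_fact f) -> Bit w b p <-> R f) ->
  PRepair Sigma w b.
Proof.
  intros HR Hb. apply repair_iff in HR; [|assumption]. destruct HR as (HD & Hc & Hmax).
  assert (E : forall f, R f <-> facts_at (Bit w b) f).
  { intros f. split.
    - intros Hf. destruct (position_of_fact f (HD f Hf)) as (p & Hp & Hpf). exists p.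
      split; [|auto]. now apply (Hb p f).
    - intros (p & Hbp & Hp & Hpf). now apply (Hb p f). }
  split.
  - apply PCons_iff; [assumption|]. now apply (consistent_ext Sigma R).
  - intros p _ Hp Nb HP. apply PCons_iff in HP; [|assumption].
    destruct (fact_of_position p Hp) as (f & Hf & Hpf).
    apply (Hmax f Hf); [rewrite <- (Hb p f); assumption|].
    apply (consistent_ext Sigma (facts_at (fun q => Bit w b q \/ SamePos w q p)));
      [|assumption].
    intros g. rewrite (facts_at_add b p f Hp Hpf). unfold add_fact. now rewrite E.
Qed.

Lemma valid_word : exists N, N < length w /\ Sym w None N /\ St w PDone N.
Proof.
  exists (length x). rewrite word_length. split; [lia|]. split.
  - unfold Sym, w. rewrite nth_error_app2 by (rewrite length_ob; lia).
    now rewrite length_ob, Nat.sub_diag.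
  - split; [rewrite word_length; lia|]. unfold w.
    rewrite firstn_app, length_ob, Nat.sub_diag, firstn_O, app_nil_r.
    rewrite firstn_all2 by (rewrite length_ob; lia). apply prun_enc_db.
Qed.

Variables (Q : list cq) (Q_safe : safe_bucq Q).

Lemma Q_iff S mu nu : PUcq w S mu Q <-> sat_ucq (facts_at S) nu Q.
Proof.
  apply PUcq_iff. intros q Hq. destruct (proj2 Q_safe q Hq) as [[_ Hs] Hc]. split.
  - intros v Hv. apply Hs. now left.
  - intros v Hv Nv. now apply Hc in Hv.
Qed.

Lemma Verifier_sound mu : Verifier Sigma Q w mu -> ~ iar_entails Sigma D Q.
Proof.
  intros HV He. apply (HV valid_word). apply (Q_iff _ mu (fun _ => 0)).
  revert He. apply sat_ucq_mono. intros f [Hf Hr].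
  destruct (position_of_fact f Hf) as (p & Hp & Hpf). exists p. split; [|auto].
  intros b _ Hb. destruct (PRepair_sound b Hb) as [H1 H2]. now apply (H2 p f), Hr.
Qed.

(** The supplied masks exclude every fact outside the intersection; other positions that happen to
    pass [PRepair] can only shrink the set further, and [Q] is monotone. *)
Lemma Verifier_complete mu : ~ iar_entails Sigma D Q ->
  (forall f, In f D -> ~ iar_set Sigma D f -> exists b R, b < length w /\
     is_repair Sigma D R /\ ~ R f /\
     forall p g, St w PPred p -> At w p (enc_fact g) -> Bit w b p <-> R g) ->
  Verifier Sigma Q w mu.
Proof.
  intros Ne Hc _ HP. apply Ne. apply (Q_iff _ mu (fun _ => 0)) in HP.
  revert HP. apply sat_ucq_mono. intros f (p & HI & Hp & Hpf).
  destruct (fact_of_position p Hp) as (g & Hg & Hpg).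
  rewrite <- (same_position_fact p f g Hpf Hpg) in Hg.
  apply NNPP. intros Nf. destruct (Hc f Hg Nf) as (b & R & Hb & HR & NR & Hm).
  apply NR, (Hm p f Hp Hpf), HI; [assumption|]. now apply (PRepair_complete b R).
Qed.
End Repairs.
End GoodWord.

(** * Certificates *)

Lemma mask_exists n (P : nat -> Prop) :
  exists m, length m = n /\ forall p, p < n -> nth p m false = true <-> P p.
Proof.
  revert P. induction n as [|n IH]; intros P.
  - exists []. split; [reflexivity|lia].
  - destruct (IH (fun p => P (S p))) as (m & Hm & H).
    assert (exists b : bool, b = true <-> P 0) as [b Hb].
    { destruct (classic (P 0)); [now exists true|].
      exists false. split; [discriminate|tauto]. }
    exists (b :: m). split; [cbn; lia|]. intros [|p] Hp; cbn; [assumption|]. apply H. lia.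
Qed.

(** The bit is set wherever the encoding of a fact of [R] can be read, possibly in the middle of
    another fact; the verifier consults only positions in state [PPred]. *)
Definition masks_repair (D : database) (R : factset) (m : list bool) : Prop :=
  forall p, p < length (enc_db D) -> nth p m false = true <->
    exists f t, R f /\ skipn p (enc_db D) = enc_fact f ++ t.

Lemma masks_exist Sigma D l : exists ms, length ms <= length l /\
  (forall m, In m ms -> length m = length (enc_db D)) /\
  forall f, In f l -> In f D -> ~ iar_set Sigma D f -> exists m R, In m ms /\
    is_repair Sigma D R /\ ~ R f /\ masks_repair D R m.
Proof.
  induction l as [|f l (ms & H1 & H2 & H3)].
  - exists []. split; [auto|]. split; [contradiction|]. contradiction.
  - destruct (classic (In f D /\ ~ iar_set Sigma D f)) as [[Hf Nf]|N].
    + assert (exists R, is_repair Sigma D R /\ ~ R f) as (R & HR & NR).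
      { apply NNPP. intros N. apply Nf. split; [assumption|]. intros R HR.
        apply NNPP. intros NR. apply N. now exists R. }
      destruct (mask_exists (length (enc_db D))
        (fun p => exists f t, R f /\ skipn p (enc_db D) = enc_fact f ++ t)) as (m & Hm & Hmp).
      exists (m :: ms). split; [cbn; lia|]. split.
      * intros m' [<-|Hm']; auto.
      * intros g [<-|Hg] HgD Ng.
        -- exists m, R. split; [now left|]. auto.
        -- destruct (H3 g Hg HgD Ng) as (m' & R' & Hin & H'). exists m', R'.
           split; [now right|assumption].
    + exists ms. split; [cbn; lia|]. split; [assumption|].
      intros g [<-|Hg] HgD Ng; [tauto|auto].
Qed.

Lemma concat_length_uniform (ms : list (list bool)) n :
  (forall m, In m ms -> length m = n) -> length (concat ms) = length ms * n.
Proof.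
  induction ms as [|m ms IH]; intros H; [reflexivity|]. cbn.
  rewrite length_app, (H m), IH; auto; [intros m' Hm'; apply H; now right|now left].
Qed.

Lemma enc_list_length {A} (f : A -> list bool) l : length l <= length (enc_list f l).
Proof.
  rewrite enc_list_items, length_app. cbn.
  enough (length l <= length (enc_items f l)) by lia.
  induction l as [|y l IH]; [cbn; lia|].
  change (S (length l) <= length (([false; true] ++ f y) ++ enc_items f l)).
  rewrite !length_app. cbn. lia.
Qed.

Lemma Bit_certificate s c1 m c2 p : p < length m ->
  Bit (ob s ++ None :: ob (c1 ++ m ++ c2)) (length s + S (length c1)) p
  <-> nth p m false = true.
Proof.
  intros Hp. set (w := ob s ++ None :: ob (c1 ++ m ++ c2)).
  assert (E : nth_error w (length s + S (length c1) + p) = Some (Some (nth p m false))).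
  { unfold w. rewrite nth_error_app2; rewrite length_ob; [|lia].
    replace (length s + S (length c1) + p - length s) with (S (length c1 + p)) by lia.
    cbn [nth_error]. unfold ob. rewrite nth_error_map, nth_error_app2 by lia.
    replace (length c1 + p - length c1) with p by lia.
    rewrite nth_error_app1 by assumption. now rewrite (nth_error_nth' m false Hp). }
  unfold Bit, Plus, Sym. split.
  - intros (j & _ & [Ej _] & Hj). rewrite <- Ej, E in Hj. congruence.
  - intros Hn. exists (length s + S (length c1) + p). rewrite E, Hn.
    assert (L : length s + S (length c1) + p < length w)
      by (apply nth_error_Some; rewrite E; discriminate).
    auto.
Qed.

Lemma certificate_exists Sigma Q D mu : (forall d, In d Sigma -> dep_wf d) ->
  acyclic Sigma -> safe_bucq Q -> ~ iar_entails Sigma D Q ->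
  exists c, length c <= length (enc_db D) * length (enc_db D) /\
    Verifier Sigma Q (ob (enc_db D) ++ None :: ob c) mu.
Proof.
  intros Hwf Hac HQ Ne. destruct (masks_exist Sigma D D) as (ms & H1 & H2 & H3).
  exists (concat ms). split.
  - rewrite (concat_length_uniform ms (length (enc_db D)) H2). apply Nat.mul_le_mono_r.
    pose proof (enc_list_length enc_fact D). unfold enc_db. lia.
  - apply (Verifier_complete D (concat ms)); auto. intros f Hf Nf.
    destruct (H3 f Hf Hf Nf) as (m & R & Hm & HR & NR & Hmask).
    apply in_split in Hm. destruct Hm as (l1 & l2 & ->).
    rewrite concat_app. cbn [concat].
    pose proof (H2 m ltac:(apply in_elt)) as Lm.
    (* The mask [m] starts after the encoding, the separator and the masks in [l1]. *)
    exists (length (enc_db D) + S (length (concat l1))), R.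
    split; [|split; [assumption|split; [assumption|]]].
    (* An encoding has at least its two final bits, so [m] is nonempty and its start is a position
       of the word. *)
    + pose proof (word_length D (concat l1 ++ m ++ concat l2)) as L. cbn zeta in L. rewrite L.
      rewrite !length_app, Lm. unfold enc_db. rewrite enc_list_items, length_app. cbn. lia.
    + intros p g Hp Hg.
      destruct (St_inside D _ _ _ Hp ltac:(discriminate)) as [Lp Es].
      assert (Lp' : p < length (enc_db D)).
      { destruct (Nat.eq_dec p (length (enc_db D))) as [E|]; [|lia]. subst p.
        rewrite firstn_all, prun_enc_db in Es. discriminate. }
      rewrite Bit_certificate by lia. rewrite (Hmask p Lp'). split.
      * intros (h & t & Hh & E). apply (At_intro D (concat l1 ++ m ++ concat l2)) in E; [|assumption].
        now rewrite (same_position_fact D _ p g h Hg E).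
      * intros Rg. destruct (St_suffix D _ _ _ Hp ltac:(discriminate)) as (h & D2 & E).
        exists h, (enc_db D2). split; [|exact E].
        apply (At_intro D (concat l1 ++ m ++ concat l2)) in E; [|assumption].
        now rewrite <- (same_position_fact D _ p g h Hg E).
Qed.

(** * Membership in coNP *)

Lemma in_P_ext (L L' : list (option bool) -> Prop) :
  (forall w, L w <-> L' w) -> in_P L -> in_P L'.
Proof.
  intros H (M & k & HM & HL). exists M, k. split; [assumption|]. intros w.
  destruct (HL w) as [H1 H2]. split; [assumption|]. now rewrite H2.
Qed.

Theorem theorem11 (Sigma : list dep) (Q : list cq) :
  (forall d, In d Sigma -> dep_wf d) ->
  acyclic Sigma ->
  safe_bucq Q ->
  in_coNP (IAR_problem Sigma Q).
Proof.
  intros Hwf Hac HQ.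
  (* [poly_bound 2 n] is [2 * n ^ 2 + 2], which exceeds the [n * n] bits of a certificate. *)
  exists 2, (fun w => Verifier Sigma Q w (fun _ => length w)). split.
  - destruct (FO_Verifier Sigma Q) as [f Hf].
    apply (in_P_ext (fun w => evalb w (fun _ => length w) f = true)).
    + intros w. apply Hf.
    + apply form_in_P.
  - intros x. split.
    + intros Nx. destruct (classic (exists D, x = enc_db D)) as [[D ->]|N].
      * destruct (certificate_exists Sigma Q D
          (fun _ => 0) Hwf Hac HQ) as (c & Lc & Hc).
        { intros He. apply Nx. now exists D. }
        exists c. split; [unfold poly_bound; cbn; lia|].
        (* The certificate was built for another valuation of the free variables; [Q] is closed, so
           [Q_iff] translates. *)
        intros Hv HP. apply (Hc Hv). revert HP. fold (ob (enc_db D)) (ob c).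
        intros HP. apply (Q_iff D c Q HQ _ (fun _ => 0) (fun _ => 0)).
        now apply (Q_iff D c Q HQ _ _ (fun _ => 0)) in HP.
      (* The only separator of this word is at [length x]; were the parser finished there, [x] would
         encode a database. So the premise of the verifier fails. *)
      * exists []. split; [cbn; lia|]. intros (n & _ & Hs & [Ln Es]) _. apply N.
        unfold Sym in Hs. rewrite length_app, length_map in Ln. cbn in Ln.
        assert (n = length x).
        { destruct (Nat.eq_dec n (length x)) as [|Hn]; [assumption|].
          rewrite nth_error_app1 in Hs by (rewrite length_map; lia).
          rewrite nth_error_map in Hs. destruct (nth_error x n); discriminate. }
        subst n. rewrite firstn_app, length_map, Nat.sub_diag, firstn_O, app_nil_r in Es.
        rewrite firstn_all2 in Es by (rewrite length_map; lia).
        exact (suffix_parse x PDb Es).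
    + intros (c & _ & Hv) (D & -> & He).
      exact (Verifier_sound D c Sigma Hwf Hac Q HQ _ Hv He).
Qed.
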